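(* Let $p$ be a prime and $r\in\mathbb{N}$. Let $m_1,\ldots,m_r,n_1,\ldots,n_r\in\mathbb{N}_0$ with $m_j\equiv n_j\bmod(p-1)p^{l_j-1}$ for $l_j\in\mathbb{N}$ $(1\leqslant j\leqslant r)$. Then, for $\gamma_1,\ldots,\gamma_r\in\mathbb{Z}_p$ and $c\in\mathbb{N}_{>1}$ with $(c,p)=1$, $$L_{p,r}(-m_1,\ldots,-m_r;\omega^{m_1},\ldots,\omega^{m_r};\gamma_1,\ldots,\gamma_r;c)\equiv L_{p,r}(-n_1,\ldots,-n_r;\omega^{n_1},\ldots,\omega^{n_r};\gamma_1,\ldots,\gamma_r;c)\pmod{p^{\min\{l_j\mid1\leqslant j\leqslant r\}}}.$$ In other words, \begin{align*} &\sum_{\substack{\xi_1^c=1\\ \xi_1\neq1}}\cdots\sum_{\substack{\xi_r^c=1\\ \xi_r\neq1}}\mathfrak{B}((m_j);(\xi_j);(\gamma_j))\\ &+\sum_{d=1}^r\left(-\frac1p\right)^d\sum_{1\leqslant i_1<\cdots<i_d\leqslant r}\sum_{\rho_{i_1}^p=1}\cdots\sum_{\rho_{i_d}^p=1}\sum_{\substack{\xi_1^c=1\\ \xi_1\neq1}}\cdots\sum_{\substack{\xi_r^c=1\\ \xi_r\neq1}}\mathfrak{B}\Bigl((m_j);\Bigl(\bigl(\prod_{j\leqslant i_l}\rho_{i_l}\bigr)^{\gamma_j}\xi_j\Bigr);(\gamma_j)\Bigr)\\ &\equiv\sum_{\substack{\xi_1^c=1\\ \xi_1\neq1}}\cdots\sum_{\substack{\xi_r^c=1\\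 \xi_r\neq1}}\mathfrak{B}((n_j);(\xi_j);(\gamma_j))\\ &\quad+\sum_{d=1}^r\left(-\frac1p\right)^d\sum_{1\leqslant i_1<\cdots<i_d\leqslant r}\sum_{\rho_{i_1}^p=1}\cdots\sum_{\rho_{i_d}^p=1}\sum_{\substack{\xi_1^c=1\\ \xi_1\neq1}}\cdots\sum_{\substack{\xi_r^c=1\\ \xi_r\neq1}}\mathfrak{B}\Bigl((n_j);\Bigl(\bigl(\prod_{j\leqslant i_l}\rho_{i_l}\bigr)^{\gamma_j}\xi_j\Bigr);(\gamma_j)\Bigr)\\ &\qquad\pmod{p^{\min\{l_j\mid1\leqslant j\leqslant r\}}}, \end{align*} where, for each $j$, $\prod_{j\leqslant i_l}\rho_{i_l}$ runs over those $l\in\{1,\ldots,d\}$ with $i_l\geqslant j$ (empty product $=1$).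
   Context: $\mathbb{N}=\{1,2,\dots\}$, $\mathbb{N}_0=\{0,1,2,\dots\}$. Both sides of the congruences are elements of $\mathbb{Z}_p$, and congruences are in $\mathbb{Z}_p$. All roots of unity are in $\mathbb{C}_p$; for $\rho^p=1$ and $\gamma\in\mathbb{Z}_p$, $\rho^\gamma=\rho^a$ for any integer $a\equiv\gamma\bmod p$. For roots of unity $\xi_1,\ldots,\xi_r\in\mathbb{C}_p\setminus\{1\}$ and $\gamma_1,\ldots,\gamma_r\in\mathbb{Z}_p$, the twisted multiple Bernoulli numbers $\mathfrak{B}((n_j);(\xi_j);(\gamma_j))$ are defined by $$\prod_{j=1}^r\frac{1}{1-\xi_j\exp\left(\gamma_j\sum_{k=j}^rt_k\right)}=\sum_{n_1=0}^\infty\cdots\sum_{n_r=0}^\infty\mathfrak{B}((n_j);(\xi_j);(\gamma_j))\frac{t_1^{n_1}}{n_1!}\cdots\frac{t_r^{n_r}}{n_r!}.$$ Put $q=4$ if $p=2$ and $q=p$ if $p\geqslant3$. Let $W=\{\pm1\}$ if $p=2$ and $W=\{\xi\in\mathbb{Z}_p^\times\mid\xi^{p-1}=1\}$ if $p\geqslant3$. Every $x\in\mathbb{Z}_p^\times$ is uniquely $x=\omega(x)\langle x\rangle$ with $\omega(x)\in W$, $\langle x\rangle\in1+q\mathbb{Z}_p$. For $z\in\mathbb{C}_p$ with $|z-1|_p\geqslant1$, $\mathfrak{m}_z$ is the measure on $\mathbb{Z}_p$ with $\mathfrak{m}_z(j+p^N\mathbb{Z}_p)=\frac{z^j}{1-z^{p^N}}$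 $(0\leqslant j\leqslant p^N-1)$. For $c\in\mathbb{N}_{>1}$ prime to $p$, $\widetilde{\mathfrak{m}}_c=\sum_{\xi^c=1,\,\xi\neq1}\mathfrak{m}_\xi$, a $\mathbb{Z}_p$-valued measure. Put $(\mathbb{Z}_p^r)'_{\{\gamma_j\}}=\{(x_j)\in\mathbb{Z}_p^r\mid p\nmid x_1\gamma_1,\ p\nmid(x_1\gamma_1+x_2\gamma_2),\ldots,\ p\nmid\sum_{j=1}^rx_j\gamma_j\}$. For $k_j\in\mathbb{Z}$ and $s_j\in\mathbb{Z}_p$ the $p$-adic multiple $L$-function is $$L_{p,r}(s_1,\ldots,s_r;\omega^{k_1},\ldots,\omega^{k_r};\gamma_1,\ldots,\gamma_r;c)=\int_{(\mathbb{Z}_p^r)'_{\{\gamma_j\}}}\prod_{i=1}^r\Bigl\langle\sum_{j=1}^ix_j\gamma_j\Bigr\rangle^{-s_i}\omega^{k_i}\Bigl(\sum_{j=1}^ix_j\gamma_j\Bigr)\prod_{j=1}^rd\widetilde{\mathfrak{m}}_c(x_j)$$ (zero if the domain is empty). *)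

(* Defs.v *)
From HB Require Import structures.
From mathcomp Require Import all_boot all_order all_algebra.
From mathcomp Require Import all_classical all_reals all_analysis.

Set Implicit Arguments.
Unset Strict Implicit.
Unset Printing Implicit Defensive.

Import Order.TTheory GRing.Theory Num.Theory.
Import numFieldNormedType.Exports.

Local Open Scope classical_set_scope.
Local Open Scope ring_scope.

Section AbsoluteValue.
Context (R : realType) (K : fieldType) (abs : K -> R).

Definition abs_cvg (u : nat -> K) (l : K) : Prop :=
  (fun n => abs (u n - l)) @ \oo --> (0 : R).

Definition abs_cauchy (u : nat -> K) : Prop :=
  forall e : R, 0 < e ->
    exists N, forall m n, (N <= m)%N -> (N <= n)%N -> abs (u m - u n) < e.

Definition abs_closure (A : set K) : set K :=
  [set x | forall e : R, 0 < e -> exists2 a, A a & abs (x - a) < e].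

Definition algebraic_over (A : set K) : set K :=
  [set x | exists2 P : {poly K}, P != 0 & (forall i, A P`_i) /\ root P x].

End AbsoluteValue.

(* C_p is given by its defining property: it is the completion of an algebraic
   closure of Q_p.  So it is an algebraically closed field, complete for an
   ultrametric absolute value with |p| = 1/p (which forces characteristic 0 and
   the p-adic absolute value on Q), in which the elements algebraic over Q_p
   are dense, Q_p being the closure of Q.  For p prime this determines C_p up
   to isometric isomorphism.  The library norm is not used because the library
   has no structure joining it with fields that are not ordered. *)
HB.mixin Record isPadicComplex (R : realType) (p : nat) (K : Type)
    of GRing.ClosedField K := {
  padic_abs : K -> R ;
  padic_abs_ge0 : forall x, 0 <= padic_abs x ;
  padic_abs_eq0 : forall x, (padic_abs x == 0) = (x == 0) ;
  padic_absM : forall x y, padic_abs (x * y) = padic_abs x * padic_abs y ;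
  padic_absD : forall x y,
    padic_abs (x + y) <= Num.max (padic_abs x) (padic_abs y) ;
  padic_abs_p : padic_abs p%:R = p%:R^-1 ;
  padic_complete : forall u : nat -> K, abs_cauchy padic_abs u ->
    exists l, abs_cvg padic_abs u l ;
  padic_algebraic_dense :
    abs_closure padic_abs
      (algebraic_over (abs_closure padic_abs (range (ratr : rat -> K)))) = setT
}.

#[short(type="padicComplexType")]
HB.structure Definition PadicComplex (R : realType) (p : nat) :=
  {K of GRing.ClosedField K & isPadicComplex R p K}.

Section PadicIntegers.
Context (R : realType) (p : nat) (Cp : padicComplexType R p).
Implicit Types x y g s u : Cp.

Definition padic_lim (u : nat -> Cp) : Cp :=
  xget 0 [set l | abs_cvg (padic_abs : Cp -> R) u l].

Definition padic_int : set Cp :=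
  abs_closure (padic_abs : Cp -> R) (range (fun a : int => a%:~R)).

Definition padic_unit : set Cp :=
  [set x | padic_int x /\ exists2 y, padic_int y & x * y = 1].

Definition padic_dvd (l : nat) x : Prop :=
  exists2 z, padic_int z & x = p%:R ^+ l * z.

(* congruence in Z_p modulo p ^ l; both sides are required to lie in Z_p *)
Definition padic_congr (l : nat) x y : Prop :=
  [/\ padic_int x, padic_int y & padic_dvd l (x - y)].

Definition padic_q : nat := if p == 2%N then 4%N else p.

Definition padic_W : set Cp :=
  if p == 2%N then [set x | x = 1 \/ x = -1]
  else [set x | padic_unit x /\ x ^+ p.-1 = 1].

(* omega(x): the w in W with x in w (1 + q Z_p), unique for x in Z_p^* *)
Definition teich x : Cp :=
  xget 1 [set w | padic_W w /\
    exists2 u, padic_int u & x = w * (1 + padic_q%:R * u)].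

(* <x> = x / omega(x) *)
Definition angle x : Cp := x / teich x.

(* u ^ s for u in 1 + q Z_p and s in Z_p, by the binomial series
   \sum_k binom(s, k) (u - 1) ^ k, i.e. exp (s log u) *)
Definition padic_pow u s : Cp :=
  padic_lim (series (fun k : nat =>
    (\prod_(i < k) (s - i%:R)) / k`!%:R * (u - 1) ^+ k)).

(* rho ^ g for rho ^ p = 1 and g in Z_p *)
Definition root_pow (rho g : Cp) : Cp :=
  rho ^ (xget (0 : int) [set a : int | padic_dvd 1 (g - a%:~R)]).

End PadicIntegers.

Section Measures.
Context (R : realType) (p : nat) (Cp : padicComplexType R p).

(* A measure on Z_p is encoded by its values on balls:
   mu N j is the measure of j + p ^ N Z_p, for 0 <= j < p ^ N. *)
Definition ball_measure : Type := nat -> nat -> Cp.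

(* m_z, meaningful for |z - 1| >= 1 *)
Definition koblitz (z : Cp) : ball_measure :=
  fun N j => z ^+ j / (1 - z ^+ (p ^ N)).

Definition nontriv_roots (c : nat) : set Cp :=
  [set xi | xi ^+ c = 1 /\ xi <> 1].

Definition koblitz_sum (c : nat) : ball_measure :=
  fun N j => \sum_(xi \in nontriv_roots c) koblitz xi N j.

(* Integral over Z_p ^ r against the r-fold product of mu, as the limit of the
   Riemann sums over the partitions of Z_p ^ r into balls of radius p ^ - N *)
Definition padic_integral (r : nat) (mu : ball_measure)
    (f : ('I_r -> Cp) -> Cp) : Cp :=
  padic_lim (fun N : nat =>
    \sum_(a : {ffun 'I_r -> 'I_(p ^ N)})
      f (fun j => (a j)%:R) * \prod_(j < r) mu N (a j)).

Definition partial_form (r : nat) (gam x : 'I_r -> Cp) (i : 'I_r) : Cp :=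
  \sum_(j < r | (j <= i)%N) x j * gam j.

Definition Lp_domain (r : nat) (gam : 'I_r -> Cp) : set ('I_r -> Cp) :=
  [set x | (forall j, padic_int (x j)) /\
           forall i, ~ padic_dvd 1 (partial_form gam x i)].

(* L_{p,r}(s; omega ^ k; gam; c) *)
Definition padic_mult_L (r : nat) (s : 'I_r -> Cp) (k : 'I_r -> int)
    (gam : 'I_r -> Cp) (c : nat) : Cp :=
  padic_integral (koblitz_sum c)
    (patch (fun=> 0) (Lp_domain gam) (fun x =>
      \prod_(i < r) (padic_pow (angle (partial_form gam x i)) (- s i)
                     * teich (partial_form gam x i) ^ k i))).

End Measures.

(* Formal power series in t_0, ..., t_(r-1), as families of coefficients *)
Section PowerSeries.
Context (K : fieldType) (r : nat).

Definition mpseries : Type := {ffun 'I_r -> nat} -> K.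
Implicit Types f g : mpseries.

Definition mps_one : mpseries := fun n => (n == [ffun=> 0%N])%:R.

Definition mps_var (k : 'I_r) : mpseries :=
  fun n => (n == [ffun i => (i == k) : nat])%:R.

Definition mps_mul f g : mpseries := fun n =>
  \sum_(ab \in [set ab : {ffun 'I_r -> nat} * {ffun 'I_r -> nat} |
                 forall i, (ab.1 i + ab.2 i)%N = n i]) f ab.1 * g ab.2.

Definition mps_inv f : mpseries :=
  xget (fun=> 0) [set g : mpseries | mps_mul f g = mps_one].

(* \sum_m f ^ m / m!, for f without constant term: then f ^ m has no
   coefficient of total degree less than m, so each sum is finite *)
Definition mps_exp f : mpseries := fun n =>
  \sum_(m < (\sum_(i < r) n i).+1) iter m (mps_mul f) mps_one n / m`!%:R.

Definition twisted_gen (xi gam : 'I_r -> K) : mpseries :=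
  \big[mps_mul/mps_one]_(j < r)
    mps_inv (fun n => mps_one n
      - xi j * mps_exp (fun n' => gam j * \sum_(k < r | (j <= k)%N) mps_var k n') n).

Definition twisted_bernoulli (n : 'I_r -> nat) (xi gam : 'I_r -> K) : K :=
  twisted_gen xi gam (finfun n) * \prod_(j < r) (n j)`!%:R.

End PowerSeries.

Section BernoulliSum.
Context (R : realType) (p : nat) (Cp : padicComplexType R p).

Definition xi_tuples (r c : nat) : set {ffun 'I_r -> Cp} :=
  [set xi | forall j, nontriv_roots c (xi j)].
Arguments xi_tuples : clear implicits.

(* families (rho_i)_(i in I) of p-th roots of unity, extended by 1 outside I *)
Definition rho_tuples (r : nat) (I : {set 'I_r}) : set {ffun 'I_r -> Cp} :=
  [set rho | forall i, if i \in I then rho i ^+ p = 1 else rho i = 1].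

(* the subset I of cardinal d stands for i_1 < ... < i_d *)
Definition bernoulli_sum (r c : nat) (gam : 'I_r -> Cp) (m : 'I_r -> nat) : Cp :=
  \sum_(xi \in xi_tuples r c) twisted_bernoulli m xi gam
  + \sum_(1 <= d < r.+1) (- p%:R^-1) ^+ d *
      \sum_(I : {set 'I_r} | #|I| == d)
        \sum_(rho \in rho_tuples I) \sum_(xi \in xi_tuples r c)
          twisted_bernoulli m
            (fun j => root_pow (\prod_(i in I | (j <= i)%N) rho i) (gam j) * xi j)
            gam.

End BernoulliSum.

(* For r > 0 this is the minimum: the starting value is an upper bound. *)
Definition min_fam (r : nat) (l : 'I_r -> nat) : nat :=
  \big[minn/(\max_(j < r) l j)%N]_(j < r) l j.

(* Main.v *)
(* A Riemann sum of the integral defining L_{p,r}(-m; omega^m; gam; c) only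
   involves x^m = <x>^m omega(x)^m.  The indicator of the domain of integration
   is prod_i (1 - 1/p sum_(rho^p = 1) rho^(x_1 gam_1 + ... + x_i gam_i)), and
   expanding it turns the Riemann sum into a combination of moments
     sum_a prod_i (a_1 gam_1 + ... + a_i gam_i)^(m_i) prod_j m_(z_j)(a_j + p^N Z_p),
   z_j being a p-th root of unity times a c-th one.  Such a moment is a
   coefficient of prod_j G_(j,N), where
     G_(j,N) = sum_(a < q) z_j^a E_j^a / (1 - z_j^q),   q = p^N,
     E_j = exp (gam_j (t_j + ... + t_r)),
   and (1 - z_j E_j) G_(j,N) = (1 - z_j^q E_j^q) / (1 - z_j^q) tends to 1
   coefficientwise.  Hence the Riemann sums converge, and the L-value is the sum
   of twisted Bernoulli numbers.  The congruence holds for Riemann sums by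
   Euler's theorem, because koblitz_sum takes values in Z_p, and passes to the
   limit. *)
From HB Require Import structures.
Require Import Defs.
From mathcomp Require Import all_boot all_order all_algebra.
From mathcomp Require Import all_classical all_reals all_analysis.
From mathcomp Require Import cyclic ring zify.

Set Implicit Arguments.
Unset Strict Implicit.
Unset Printing Implicit Defensive.

Import Order.TTheory GRing.Theory Num.Theory.
Import numFieldNormedType.Exports.

Local Open Scope classical_set_scope.
Local Open Scope ring_scope.

(** * Formal power series in several variables as a commutative ring *)

Section PowerSeriesRing.
Context (K : fieldType) (r : nat).
Local Notation expo := {ffun 'I_r -> nat}.

(** Exponents with all entries below [M] form a finite type, so that convolutions become ordinary
    finite sums. *)
Definition expo_of (M : nat) (a : {ffun 'I_r -> 'I_M}) : expo :=
  [ffun i => val (a i)].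

Lemma expo_of_inj M : injective (@expo_of M).
Proof.
by move=> a b /ffunP h; apply/ffunP => i; have := h i; rewrite !ffunE => /val_inj.
Qed.

Lemma ltn_expo_of M (a : {ffun 'I_r -> 'I_M}) i : (expo_of a i < M)%N.
Proof. by rewrite ffunE ltn_ord. Qed.

Lemma expo_of_surj M (n : expo) : (forall i, (n i < M)%N) ->
  exists a : {ffun 'I_r -> 'I_M}, expo_of a = n.
Proof.
move=> nM; exists [ffun i => Ordinal (nM i)].
by apply/ffunP => i; rewrite !ffunE.
Qed.

Lemma ltn_expo_sum (n : expo) i : (n i < (\sum_i n i).+1)%N.
Proof. by rewrite ltnS (bigD1 i)//= leq_addr. Qed.

(** Two exponents adding up to [n] are bounded by [n] entrywise, so any [M] above the entries of [n]
    will do. This freedom lets nested convolutions share one [M]. *)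
Lemma mps_mulE M (f g : mpseries K r) (n : expo) : (forall i, (n i < M)%N) ->
  mps_mul f g n =
  \sum_(a : {ffun 'I_r -> 'I_M}) \sum_(b : {ffun 'I_r -> 'I_M})
    (expo_of a + expo_of b == n)%:R * (f (expo_of a) * g (expo_of b)).
Proof.
move=> nM; rewrite pair_big /=.
under eq_bigr => x _ do rewrite mulr_natl mulrb.
rewrite -big_mkcond /= /mps_mul.
rewrite (@bigfs _ _ _ _ _ (fun x => expo_of x.1 + expo_of x.2 == n)) ?index_enum_uniq//; last first.
  by move=> x _; rewrite mem_index_enum.
apply: (@reindex_fsbig _ _ _ _ _ (fun x => (expo_of x.1, expo_of x.2))).
split.
- move=> x /= /eqP <- i.
  by rewrite [RHS]ffunE.
- move=> x y _ _ [] /expo_of_inj e1 /expo_of_inj e2.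
  by case: x y e1 e2 => [? ?] [? ?] /= -> ->.
- move=> [a b] /= h.
  have [a' aE] : exists a' : {ffun 'I_r -> 'I_M}, expo_of a' = a.
    by apply: expo_of_surj => i; apply: leq_ltn_trans (nM i); rewrite -h leq_addr.
  have [b' bE] : exists a' : {ffun 'I_r -> 'I_M}, expo_of a' = b.
    by apply: expo_of_surj => i; apply: leq_ltn_trans (nM i); rewrite -h leq_addl.
  exists (a', b') => /=; last by rewrite aE bE.
  by apply/eqP/ffunP => i; rewrite ffunE aE bE -h.
Qed.

Lemma sum_expo_eq M (F : expo -> K) (n : expo) : (forall i, (n i < M)%N) ->
  \sum_(a : {ffun 'I_r -> 'I_M}) (expo_of a == n)%:R * F (expo_of a) = F n.
Proof.
move=> /expo_of_surj[n' <-].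
rewrite (bigD1 n')//= eqxx mul1r big1 ?addr0// => a an.
by rewrite (inj_eq (@expo_of_inj M)) (negPf an) mul0r.
Qed.

(* A copy of mpseries with the convolution product: the library already makes
   functions into a ring for the pointwise product. *)
Definition mps := mpseries K r.

HB.instance Definition _ := GRing.Zmodule.copy mps (expo -> K).

Lemma mps_mulC : commutative (@mps_mul K r : mps -> mps -> mps).
Proof.
move=> f g; apply/funext => n.
rewrite !(@mps_mulE (\sum_i n i).+1); try exact: ltn_expo_sum.
rewrite exchange_big.
by apply: eq_bigr => a _; apply: eq_bigr => b _; rewrite addrC (mulrC (f _)).
Qed.

Lemma mps_mulDl : left_distributive (@mps_mul K r : mps -> mps -> mps) +%R.
Proof.
move=> f g h; apply/funext => n.
change (mps_mul (f + g) h n = mps_mul f h n + mps_mul g h n).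
rewrite !(@mps_mulE (\sum_i n i).+1); try exact: ltn_expo_sum.
rewrite -big_split; apply: eq_bigr => a _; rewrite -big_split /=.
by apply: eq_bigr => b _; rewrite -mulrDr -mulrDl.
Qed.

Lemma mps_mul1 : left_id (@mps_one K r) (@mps_mul K r : mps -> mps -> mps).
Proof.
move=> f; apply/funext => n.
rewrite (@mps_mulE (\sum_i n i).+1); last exact: ltn_expo_sum.
have e0 : [ffun=> 0%N] = 0 :> expo by apply/ffunP => i; rewrite !ffunE.
rewrite exchange_big /=.
under eq_bigr => b _.
  under eq_bigr => a _.
    rewrite mulrCA /mps_one.
    over.
  rewrite (@sum_expo_eq _ (fun a => (a + expo_of b == n)%:R * f (expo_of b))); last first.
    by move=> i; rewrite ffunE.
  rewrite e0 add0r.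
  over.
by apply: sum_expo_eq; exact: ltn_expo_sum.
Qed.

(* Both bracketings equal the symmetric sum over a + b + c = n. *)
Lemma mps_mulA_sum (f g h : mps) (n : expo) M : (forall i, (n i < M)%N) ->
  mps_mul (mps_mul f g) h n =
  \sum_(a : {ffun 'I_r -> 'I_M}) \sum_(b : {ffun 'I_r -> 'I_M})
  \sum_(c : {ffun 'I_r -> 'I_M}) (expo_of a + expo_of b + expo_of c == n)%:R *
    (f (expo_of a) * g (expo_of b) * h (expo_of c)).
Proof.
move=> nM; rewrite (mps_mulE _ _ nM).
under [RHS]eq_bigr => a _ do rewrite exchange_big.
rewrite exchange_big [RHS]exchange_big /=; apply: eq_bigr => c _.
transitivity (\sum_(d : {ffun 'I_r -> 'I_M}) \sum_(a : {ffun 'I_r -> 'I_M})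
   \sum_(b : {ffun 'I_r -> 'I_M}) (expo_of d == expo_of a + expo_of b)%:R *
   ((expo_of d + expo_of c == n)%:R * (f (expo_of a) * g (expo_of b) * h (expo_of c)))).
  apply: eq_bigr => d _; rewrite (@mps_mulE M); last exact: ltn_expo_of.
  rewrite mulr_suml mulr_sumr; apply: eq_bigr => a _.
  rewrite mulr_suml mulr_sumr; apply: eq_bigr => b _.
  by rewrite (eq_sym (expo_of d)); ring.
rewrite exchange_big; apply: eq_bigr => a _.
rewrite exchange_big; apply: eq_bigr => b _.
(* If a + b + c = n, then a + b still lies below [M] and is the only [d] that contributes; otherwise
   every term has a zero factor. *)
case: (pselect (expo_of a + expo_of b + expo_of c = n)) => [abc|nabc].
  rewrite (@sum_expo_eq _ (fun x => (x + expo_of c == n)%:R * _))//.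
  move=> i; apply: leq_ltn_trans (nM i).
  by rewrite -abc [X in (_ <= X)%N]ffunE leq_addr.
rewrite big1 => [|d _].
  by have /eqP/negPf-> := nabc; rewrite mul0r.
have [->|] := eqVneq; last by rewrite mul0r.
by have /eqP/negPf-> := nabc; rewrite mul0r mulr0.
Qed.

Lemma mps_mulA : associative (@mps_mul K r : mps -> mps -> mps).
Proof.
move=> f g h; apply/funext => n.
have nM := @ltn_expo_sum n.
(* The first rewrite expands the right-hand side; commutativity then makes the left-hand side (g h)
   f, which the same formula expands. *)
rewrite (mps_mulA_sum _ _ _ nM) mps_mulC (mps_mulA_sum _ _ _ nM).
under [LHS]eq_bigr => a _ do rewrite exchange_big.
rewrite [LHS]exchange_big /=.
apply: eq_bigr => a _; apply: eq_bigr => b _; apply: eq_bigr => c _.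
by rewrite (addrC _ (expo_of a)) addrA (mulrC _ (f _)) !mulrA.
Qed.

Lemma mps_one_neq0 : @mps_one K r != 0 :> mps.
Proof.
apply/eqP => /(congr1 (fun f : mps => f [ffun=> 0%N])).
by rewrite /mps_one eqxx => /eqP; rewrite oner_eq0.
Qed.

HB.instance Definition _ := GRing.Zmodule_isComNzRing.Build mps
  mps_mulA mps_mulC mps_mul1 mps_mulDl mps_one_neq0.

Lemma mpsD (f g : mps) n : (f + g) n = f n + g n. Proof. by []. Qed.
Lemma mpsN (f : mps) n : (- f) n = - f n. Proof. by []. Qed.
Lemma mpsM (f g : mps) : f * g = mps_mul f g. Proof. by []. Qed.
Lemma mps1 : 1 = @mps_one K r :> mps. Proof. by []. Qed.
Lemma mps_sum I (s : seq I) (P : pred I) (F : I -> mps) n :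
  (\sum_(i <- s | P i) F i) n = \sum_(i <- s | P i) F i n.
Proof. by elim/big_rec2: _ => // i x y _ <-. Qed.

End PowerSeriesRing.

(** * Order of vanishing and inverses of power series *)

Section PowerSeriesInverse.
Context (K : fieldType) (r : nat).
Local Notation expo := {ffun 'I_r -> nat}.
Local Notation mps := (mps K r).
Implicit Types (n : expo) (f g u : mps).

Definition expo_deg n : nat := \sum_i n i.

Lemma expo_degD (a b : expo) : expo_deg (a + b) = (expo_deg a + expo_deg b)%N.
Proof. by rewrite /expo_deg -big_split; apply: eq_bigr => i _; rewrite ffunE. Qed.

(** Membership of [f] in the [d]-th power of the ideal of series without constant term. *)
Definition mps_order_ge (d : nat) f : Prop :=
  forall n, (expo_deg n < d)%N -> f n = 0.

Lemma mps_order_geM d e f g :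
  mps_order_ge d f -> mps_order_ge e g -> mps_order_ge (d + e) (f * g).
Proof.
move=> fd ge n nde; rewrite mpsM (mps_mulE _ _ (@ltn_expo_sum _ n)).
rewrite big1// => a _; rewrite big1// => b _.
have [abn|] := eqVneq; last by rewrite mul0r.
have abde : (expo_deg (expo_of a) + expo_deg (expo_of b) < d + e)%N.
  by rewrite -expo_degD abn.
have [ad|da] := ltnP (expo_deg (expo_of a)) d; first by rewrite fd// mul0r mulr0.
rewrite ge ?mulr0//; lia.
Qed.

Lemma mps_order_geX f d : mps_order_ge 1 f -> mps_order_ge d (f ^+ d).
Proof.
move=> f1; elim: d => [|d IH]; first by [].
by rewrite exprS -add1n; exact: mps_order_geM.
Qed.

Lemma mps_order_ge_sum I (s : seq I) (P : pred I) (F : I -> mps) d :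
  (forall i, P i -> mps_order_ge d (F i)) -> mps_order_ge d (\sum_(i <- s | P i) F i).
Proof.
by move=> h n nd; rewrite mps_sum big1// => i Pi; apply: h.
Qed.

Definition mpsC (c : K) : mps := fun n => c * mps_one K n.

Lemma mpsCE c f n : (mpsC c * f) n = c * f n.
Proof.
rewrite -{2}(mul1r f) !mpsM mps1 !(mps_mulE _ _ (@ltn_expo_sum _ n)).
rewrite mulr_sumr; apply: eq_bigr => a _; rewrite mulr_sumr; apply: eq_bigr => b _.
by rewrite /mpsC; ring.
Qed.

Lemma mpsC1 : mpsC 1 = 1.
Proof. by apply/funext => n; rewrite /mpsC mul1r. Qed.

Lemma mpsCM c d : mpsC (c * d) = mpsC c * mpsC d.
Proof. by apply/funext => n; rewrite mpsCE /mpsC mulrA. Qed.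

Lemma mpsCX c k : mpsC (c ^+ k) = mpsC c ^+ k.
Proof. by elim: k => [|k IH]; rewrite ?expr0 ?mpsC1// !exprS mpsCM IH. Qed.

Lemma expo_deg0 n : expo_deg n = 0%N -> n = [ffun=> 0%N].
Proof.
move=> h; apply/ffunP => i; rewrite ffunE; apply/eqP; rewrite -leqn0 -h.
by rewrite /expo_deg (bigD1 i)//= leq_addr.
Qed.

(* The geometric series sum_k (1 - u / u_0)^k / u_0, truncated at the degree of
   the coefficient. *)
Lemma mps_unit u : u [ffun=> 0%N] != 0 -> exists g, u * g = 1.
Proof.
set c := u _ => c0.
pose v : mps := 1 - mpsC c^-1 * u.
have v1 : mps_order_ge 1 v.
  move=> n; rewrite ltnS leqn0 => /eqP /expo_deg0 ->.
  by rewrite /v mpsD mpsN mpsCE mulVf// mps1 /mps_one eqxx subrr.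
pose h d : mps := mpsC c^-1 * \sum_(k < d) v ^+ k.
have uh d : u * h d = 1 - v ^+ d.
  rewrite /h mulrA (mulrC u) -[X in X * _](subrK 1) -[X in X + 1]opprB addrC -/v.
  by rewrite -opprB mulNr -subrX1 opprB.
(* Powers of [v] with exponent at least [d] have order at least [d], so they do not affect
   coefficients of degree below [d]. *)
have hstab k d e : (expo_deg k < d)%N -> h (d + e)%N k = h d k.
  move=> kd; rewrite /h !mpsCE big_split_ord /= mpsD [X in _ + X](_ : _ = 0) ?addr0//.
  apply: (@mps_order_ge_sum _ _ _ _ d) => // i _ j jd.
  by apply: (mps_order_geX v1); rewrite ltn_addr.
exists (fun n => h (expo_deg n).+1 n); apply/funext => n.
(* The inverse is a diagonal of partial sums. It is compared with the single partial sum
   [h (expo_deg n).+1], from which it differs only in degrees above that of [n]. *)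
have -> : (fun n => h (expo_deg n).+1 n) =
    h (expo_deg n).+1 + ((fun n => h (expo_deg n).+1 n) - h (expo_deg n).+1) :> mps.
  by rewrite addrC subrK.
rewrite mulrDr mpsD uh mpsD mpsN.
rewrite (@mps_order_geX v (expo_deg n).+1 v1 n)// subr0.
rewrite [X in _ + X](@mps_order_geM 0 (expo_deg n).+1 _ _ _ _ n) ?addr0//.
move=> k kn; rewrite mpsD mpsN -(subnKC kn) hstab ?subrr//.
Qed.

Lemma mps_invP u : u [ffun=> 0%N] != 0 -> u * mps_inv u = 1.
Proof.
move=> /mps_unit[g ug].
change (mps_mul u (mps_inv u) = @mps_one K r).
by rewrite /mps_inv; case: xgetP => [h _ //|/(_ g)/(_ ug)].
Qed.

End PowerSeriesInverse.

(** * Exponentials of linear forms in characteristic zero *)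

Section PowerSeriesExp.
Context (K : fieldType) (r : nat).
Hypothesis natK0 : forall k : nat, (k%:R == 0 :> K) = (k == 0)%N.
Local Notation expo := {ffun 'I_r -> nat}.
Local Notation mps := (mps K r).
Implicit Types (n : expo) (b : 'I_r -> K).

Let fact_neq0 k : k`!%:R != 0 :> K.
Proof. by rewrite natK0 -lt0n fact_gt0. Qed.

(** The series exp(b_1 t_1 + ... + b_r t_r) in closed form; [mps_expE] identifies it with the value
    of [mps_exp]. *)
Definition mexp b : mps := fun n => \prod_k (b k ^+ n k / (n k)`!%:R).

(** Coefficient form of the differential equation d/dt_k exp(L) = b_k exp(L), where L is the linear
    form with coefficients [b]. *)
Lemma mexp_shift b n k (a : expo) : [ffun i => (i == k) : nat] + a = n ->
  b k * mexp b a = (n k)%:R * mexp b n.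
Proof.
move=> en.
have nk : n k = (a k).+1 by rewrite -en !ffunE eqxx.
have ni i : i != k -> n i = a i by move=> /negPf ik; rewrite -en !ffunE ik.
rewrite /mexp (bigD1 k)//= [in RHS](bigD1 k)//= nk.
rewrite [in RHS](eq_bigr (fun i => b i ^+ a i / (a i)`!%:R)); last first.
  by move=> i /ni ->.
rewrite factS natrM exprS; move: (fact_neq0 (a k)) => h.
have h' : (a k).+1%:R != 0 :> K by rewrite natK0.
by field; rewrite h nat1r.
Qed.

(** L^d / d! is the homogeneous part of degree d of exp(L). In the induction, multiplication by L
    shifts exponents by one unit, [mexp_shift] turns each shift into a factor n_k, and the n_k add
    up to d + 1. *)
Lemma mps_linear_form_iter b d n :
  iter d (mps_mul (fun n => \sum_k b k * mps_var K k n)) (@mps_one K r) n =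
  if expo_deg n == d then d`!%:R * mexp b n else 0.
Proof.
elim: d n => [|d IH] n /=.
  rewrite /mps_one; case: ifPn => [/eqP/expo_deg0 ->|].
    rewrite eqxx mul1r /mexp big1// => i _.
    by rewrite ffunE expr0 fact0 divr1.
  have [->|//] := eqVneq n [ffun=> 0%N]; rewrite /expo_deg big1// => i _.
  by rewrite ffunE.
(* The bound exceeds 1 so that the exponents of the single variables are in range too. *)
have [M M1 nM] : exists2 M, (1 < M)%N & forall i, (n i < M)%N.
  by exists (expo_deg n).+2 => // i; rewrite ltnW// ltnS ltn_expo_sum.
rewrite (mps_mulE _ _ nM) exchange_big /=.
transitivity (\sum_(a : {ffun 'I_r -> 'I_M}) \sum_k
   ([ffun i => (i == k) : nat] + expo_of a == n)%:R *
   (if expo_deg n == d.+1 then d`!%:R * ((n k)%:R * mexp b n) else 0)).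
  apply: eq_bigr => a _.
  under eq_bigr => c _.
    rewrite IH mulr_suml mulr_sumr.
    over.
  rewrite exchange_big; apply: eq_bigr => k _.
  transitivity (\sum_(c : {ffun 'I_r -> 'I_M})
     (expo_of c == [ffun i => (i == k) : nat])%:R * ((expo_of c + expo_of a == n)%:R *
     (b k * (if expo_deg (expo_of a) == d then d`!%:R * mexp b (expo_of a) else 0)))).
    by apply: eq_bigr => c _; rewrite /mps_var; ring.
  rewrite (@sum_expo_eq _ _ _ (fun c => (c + expo_of a == n)%:R * _)); last first.
    by move=> i; rewrite ffunE (leq_ltn_trans (leq_b1 _)).
  have [en|] := eqVneq; last by rewrite !mul0r.
  have dn : expo_deg n = (expo_deg (expo_of a)).+1.
    rewrite -[X in expo_deg X = _]en expo_degD /expo_deg (bigD1 k)//= ffunE eqxx big1 ?addn0 ?add1n//.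
    by move=> i /negPf ik; rewrite ffunE ik.
  rewrite dn eqSS; case: ifP => _; last by rewrite mulr0.
  by rewrite -(mexp_shift b en); ring.
rewrite exchange_big /=; under eq_bigr => k _ do rewrite -mulr_suml.
case: ifPn => [/eqP nd|nd]; last by rewrite big1// => k _; rewrite mulr0.
rewrite factS natrM -nd {1}/expo_deg natr_sum !mulr_suml; apply: eq_bigr => k _.
have [nk0|nk0] := eqVneq (n k) 0%N; first by rewrite nk0 !mul0r !mulr0.
suff -> : \sum_(a : {ffun 'I_r -> 'I_M})
   ([ffun i => (i == k) : nat] + expo_of a == n)%:R = 1 :> K by ring.
(* The only exponent that contributes is [n] lowered by one at [k]; the truncated subtraction is
   exact because [n k] is nonzero. *)
pose n' : expo := [ffun i => (n i - (i == k))%N].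
rewrite -[RHS](@sum_expo_eq _ _ M (fun=> 1) n'); last first.
  by move=> i; rewrite ffunE (leq_ltn_trans (leq_subr _ _)).
apply: eq_bigr => a _; rewrite mulr1; congr (_ %:R); congr nat_of_bool.
have aux : [ffun i => (i == k) : nat] + n' = n.
  apply/ffunP => i; rewrite !ffunE [LHS]addnC subnK//.
  by case: eqVneq => // ->; rewrite lt0n.
rewrite -aux; apply/eqP/eqP => [|->//].
move=> /ffunP e; apply/ffunP => i; have := e i.
by rewrite [LHS]ffunE [RHS]ffunE => /addnI.
Qed.

(** Only the power equal to the total degree of [n] contributes, and it is the last one of the
    truncated sum. *)
Lemma mps_expE b : mps_exp (fun n => \sum_k b k * mps_var K k n) = mexp b.
Proof.
apply/funext => n; rewrite /mps_exp.
under eq_bigr => d _ do rewrite mps_linear_form_iter.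
rewrite (bigD1 ord_max)//= -/(expo_deg n) eqxx big1 ?addr0; last first.
  move=> i /eqP ni; case: eqP => [e|_]; last by rewrite mul0r.
  by case: ni; apply: val_inj; rewrite /= -e.
by rewrite mulrAC divff ?mul1r// fact_neq0.
Qed.

(** The coefficient of t^k in exp(xt) exp(yt) = exp((x + y)t): the binomial theorem divided by
    k!. *)
Lemma exp_coef_add (x y : K) k M : (k < M)%N ->
  \sum_(i < M) \sum_(j < M) ((i + j)%N == k)%:R * (x ^+ i / i`!%:R * (y ^+ j / j`!%:R))
  = (x + y) ^+ k / k`!%:R.
Proof.
move=> kM; rewrite exprDn mulr_suml exchange_big /=.
rewrite (big_ord_widen _ (fun i => (x ^+ (k - i) * y ^+ i *+ 'C(k, i)) / k`!%:R) kM).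
rewrite [RHS]big_mkcond; apply: eq_bigr => j _ /=.
rewrite ltnS; case: leqP => [jk|kj]; last first.
  rewrite big1// => i _; case: eqVneq => [e|]; last by rewrite mul0r.
  by move: kj; rewrite -e; lia.
have kjM : (k - j < M)%N by rewrite (leq_ltn_trans (leq_subr _ _)).
rewrite (bigD1 (Ordinal kjM))//= subnK// eqxx mul1r big1 ?addr0; last first.
  move=> i /eqP ik; case: eqVneq => [e|]; last by rewrite mul0r.
  by case: ik; apply: val_inj; rewrite /= -e addnK.
have := bin_fact jk => /(congr1 (fun q : nat => q%:R : K)); rewrite !natrM => <-.
move: (fact_neq0 j) (fact_neq0 (k - j)) => h1 h2.
have h3 : 'C(k, j)%:R != 0 :> K by rewrite natK0 -lt0n bin_gt0.
by field; rewrite h1 h2 h3.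
Qed.

(** The coefficients factor over the variables, so [exp_coef_add] applies in each variable and the
    product of sums is expanded. *)
Lemma mexpD b b' : mexp (fun k => b k + b' k) = mexp b * mexp b'.
Proof.
apply/funext => n; rewrite mpsM (mps_mulE _ _ (@ltn_expo_sum _ n)) /mexp.
have nM := @ltn_expo_sum _ n.
under eq_bigr => k _ do rewrite -(exp_coef_add _ _ (nM k)).
rewrite bigA_distr_bigA; apply: eq_bigr => a _.
rewrite bigA_distr_bigA; apply: eq_bigr => c _.
rewrite [LHS]big_split [X in _ * X = _]big_split /=; congr (_ * (_ * _)).
(* The Kronecker deltas of the single variables multiply to the delta of the exponents. *)
- have [e|ne] := eqVneq (expo_of a + expo_of c) n.
    rewrite big1// => i _; move/ffunP: e => /(_ i); rewrite !ffunE.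
    by move=> /eqP ->.
  apply/eqP; rewrite prodf_seq_eq0; apply/hasP.
  have [i ni] : exists i, (expo_of a + expo_of c) i != n i.
    by apply/existsP; apply: contraR ne => /existsPn h; apply/eqP/ffunP => i; apply/eqP/negPn/h.
  exists i; rewrite ?mem_index_enum//=.
  by move: ni; rewrite !ffunE => /negPf; rewrite /= => ->.
- by apply: eq_bigr => i _; rewrite ffunE.
- by apply: eq_bigr => i _; rewrite ffunE.
Qed.

Lemma mexp0 : mexp (fun=> 0) = 1.
Proof.
apply/funext => n; rewrite /mexp mps1 /mps_one.
have [->|n0] := eqVneq; first by rewrite big1// => i _; rewrite ffunE expr0 fact0 divr1.
have [i ni] : exists i, n i != 0%N.
  apply/existsP; apply: contraR n0 => /existsPn h.
  by apply/eqP/ffunP => i; rewrite ffunE; apply/eqP/negPn/h.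
by rewrite (bigD1 i)//= expr0n (negPf ni) mul0r mul0r.
Qed.

Lemma mexpX b k : mexp b ^+ k = mexp (fun i => k%:R * b i).
Proof.
elim: k => [|k IH].
  by rewrite expr0 -mexp0; congr mexp; apply/funext => i; rewrite mul0r.
by rewrite exprS IH -mexpD; congr mexp; apply/funext => i; rewrite -nat1r mulrDl mul1r.
Qed.

Lemma mexp_prod J (s : seq J) (B : J -> 'I_r -> K) :
  \prod_(j <- s) mexp (B j) = mexp (fun i => \sum_(j <- s) B j i).
Proof.
elim: s => [|j s IH].
  by rewrite big_nil -mexp0; congr mexp; apply/funext => i; rewrite big_nil.
by rewrite big_cons IH -mexpD; congr mexp; apply/funext => i; rewrite big_cons.
Qed.

End PowerSeriesExp.

(** * The absolute value of C_p, limits, and the ring Z_p *)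

Section PadicAbs.
Context (R : realType) (p : nat) (Cp : padicComplexType R p).
Hypothesis hp : prime p.
Local Notation v := (padic_abs : Cp -> R).
Local Notation eps l := ((p%:R^-1 : R) ^+ l).
Implicit Types (x y g : Cp) (k l : nat).

Lemma abs0 : v 0 = 0. Proof. by apply/eqP; rewrite padic_abs_eq0. Qed.

Lemma abs1 : v 1 = 1.
Proof.
have h : v 1 != 0 by rewrite padic_abs_eq0 oner_eq0.
by apply: (mulfI h); rewrite -padic_absM !mulr1.
Qed.

Lemma absX x k : v (x ^+ k) = v x ^+ k.
Proof. by elim: k => [|k IH]; rewrite ?expr0 ?abs1// !exprS padic_absM IH. Qed.

Lemma abs_unity_root x k : (0 < k)%N -> x ^+ k = 1 -> v x = 1.
Proof.
move=> k0 xk; apply/eqP; rewrite -(@pexpr_eq1 _ _ k)// ?padic_abs_ge0//.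
by rewrite -absX xk abs1.
Qed.

Lemma absN x : v (- x) = v x.
Proof.
rewrite -mulN1r padic_absM (@abs_unity_root _ 2) ?mul1r//.
by rewrite sqrrN expr1n.
Qed.

Lemma absB_sym x y : v (x - y) = v (y - x).
Proof. by rewrite -absN opprB. Qed.

Lemma absV x : v x^-1 = (v x)^-1.
Proof.
have [->|x0] := eqVneq x 0; first by rewrite invr0 abs0 invr0.
have h : v x != 0 by rewrite padic_abs_eq0.
by apply: (mulfI h); rewrite -padic_absM !divff// abs1.
Qed.

Lemma absD_le C x y : v x <= C -> v y <= C -> v (x + y) <= C.
Proof. by move=> h1 h2; apply: (le_trans (padic_absD _ _)); rewrite ge_max h1. Qed.

Lemma absB_le C x y : v x <= C -> v y <= C -> v (x - y) <= C.
Proof. by move=> h1 h2; apply: absD_le; rewrite ?absN. Qed.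

Lemma absD_lt C x y : v x < C -> v y < C -> v (x + y) < C.
Proof. by move=> h1 h2; apply: (le_lt_trans (padic_absD _ _)); rewrite gt_max h1. Qed.

Lemma abs_sum_le (I : Type) (s : seq I) (P : pred I) (F : I -> Cp) C :
  0 <= C -> (forall i, P i -> v (F i) <= C) -> v (\sum_(i <- s | P i) F i) <= C.
Proof.
by move=> C0 h; elim/big_ind : _ => //; [rewrite abs0|move=> *; exact: absD_le].
Qed.

Lemma absM_le1 x y C : v x <= 1 -> v y <= C -> v (x * y) <= C.
Proof.
move=> h1 h2; rewrite padic_absM; apply: le_trans h2.
by rewrite ler_piMl// padic_abs_ge0.
Qed.

Lemma abs_nat_le1 k : v k%:R <= 1.
Proof.
by elim: k => [|k IH]; [rewrite abs0|rewrite -nat1r absD_le// abs1].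
Qed.

Lemma abs_int_le1 (a : int) : v a%:~R <= 1.
Proof. by case: a => k; rewrite ?NegzE ?mulrNz ?absN; exact: abs_nat_le1. Qed.

Lemma p_gt0 : (0 : R) < p%:R.
Proof. by rewrite ltr0n prime_gt0. Qed.

Lemma eps_ge0 l : 0 <= eps l. Proof. by rewrite exprn_ge0// invr_ge0 ler0n. Qed.

Lemma eps_gt0 l : 0 < eps l. Proof. by rewrite exprn_gt0// invr_gt0 p_gt0. Qed.

Lemma pV_lt1 : (p%:R^-1 : R) < 1.
Proof. by rewrite invf_lt1 ?p_gt0// ltr1n prime_gt1. Qed.

Lemma eps_le k l : (eps k <= eps l) = (l <= k)%N.
Proof. by rewrite ler_iXn2l// ?invr_gt0 ?p_gt0 ?pV_lt1. Qed.

Lemma abs_pX l : v (p%:R ^+ l) = eps l.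
Proof. by rewrite absX padic_abs_p. Qed.

Lemma eps_arch (e : R) : 0 < e -> exists l, eps l < e.
Proof.
move=> e0.
have := @cvg_expr R p%:R^-1.
rewrite ger0_norm ?invr_ge0 ?ler0n// pV_lt1 => /(_ isT) /cvgrPdist_lt/(_ e e0).
by case=> N _ /(_ N (leqnn N)); rewrite /= sub0r normrN ger0_norm ?eps_ge0// => h; exists N.
Qed.

(** Bezout gives 1 = a k - b p; as |p| < 1, the assumption |k| < 1 would force |1| < 1. *)
Lemma abs_coprime k : coprime k p -> v k%:R = 1.
Proof.
move=> kp; apply/eqP; rewrite eq_le abs_nat_le1 /=.
have k0 : (0 < k)%N.
  by case: k kp => //; rewrite /coprime gcd0n => /eqP p1; move: hp; rewrite p1.
case: (egcdnP p k0) => a b e _; move: kp; rewrite /coprime => /eqP kp.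
rewrite leNgt; apply/negP => h.
suff : v 1 < 1 by rewrite abs1 ltxx.
have -> : 1 = a%:R * k%:R - b%:R * p%:R :> Cp.
  by rewrite -!natrM e kp natrD addrAC subrr add0r.
rewrite absD_lt ?absN// padic_absM.
  by rewrite (le_lt_trans _ h)// ler_piMl ?padic_abs_ge0 ?abs_nat_le1.
by rewrite padic_abs_p (le_lt_trans _ pV_lt1)// ler_piMl ?invr_ge0 ?ler0n ?abs_nat_le1.
Qed.

Lemma abs_natE k : (0 < k)%N -> v k%:R = eps (logn p k).
Proof.
move=> k0; case: (pfactor_coprime hp k0) => j pj {1}->.
by rewrite natrM natrX padic_absM abs_pX abs_coprime ?mul1r// coprime_sym.
Qed.

Lemma natCp_eq0 k : (k%:R == 0 :> Cp) = (k == 0)%N.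
Proof.
have [->|k0] := posnP k; first by rewrite !eqxx.
by rewrite -padic_abs_eq0 abs_natE// gt_eqF ?eps_gt0// (gtn_eqF k0).
Qed.

Lemma abs_nat_le k l : (v k%:R <= eps l) <-> (p ^ l %| k)%N.
Proof.
have [->|k0] := posnP k; first by rewrite dvdn0 abs0 eps_ge0.
by rewrite abs_natE// eps_le pfactor_dvdn.
Qed.

Lemma abs_int_le (a : int) l : (v a%:~R <= eps l) <-> (p ^ l %| `|a|)%N.
Proof.
rewrite -abs_nat_le; case: a => k /=; first by [].
by rewrite NegzE mulrNz absN.
Qed.

Lemma abs_eqmod (a b l : nat) : a = b %[mod p ^ l] -> v (a%:R - b%:R) <= eps l.
Proof.
wlog ab : a b / (a <= b)%N => [hw h|/esym/eqP].
  by have /orP[|] := leq_total a b => ab; [|rewrite absB_sym]; apply: hw.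
by rewrite eqn_mod_dvd// => d; rewrite absB_sym -natrB// abs_nat_le.
Qed.

Lemma abs_cvgP (u : nat -> Cp) x : abs_cvg v u x <->
  (forall e, 0 < e -> exists N, forall n, (N <= n)%N -> v (u n - x) < e).
Proof.
split=> [/cvgrPdist_lt h e e0|h].
  have [N _ hN] := h e e0; exists N => n Nn.
  by have := hN n Nn; rewrite /= sub0r normrN ger0_norm ?padic_abs_ge0.
apply/cvgrPdist_lt => e e0; have [N hN] := h e e0; exists N => // n Nn.
by rewrite /= sub0r normrN ger0_norm ?padic_abs_ge0// hN.
Qed.

Lemma abs_cvg_unique u x y : abs_cvg v u x -> abs_cvg v u y -> x = y.
Proof.
move=> /abs_cvgP h1 /abs_cvgP h2; apply/eqP; rewrite -subr_eq0 -padic_abs_eq0.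
rewrite eq_le padic_abs_ge0 andbT leNgt; apply/negP => h.
have [N1 H1] := h1 _ h; have [N2 H2] := h2 _ h.
suff : v (x - y) < v (x - y) by rewrite ltxx.
rewrite {1}(_ : x - y = - (u (maxn N1 N2) - x) + (u (maxn N1 N2) - y)); last by ring.
by rewrite absD_lt ?absN ?H1 ?H2 ?leq_maxl ?leq_maxr.
Qed.

Lemma padic_limE u x : abs_cvg v u x -> padic_lim u = x.
Proof.
move=> h; rewrite /padic_lim; case: xgetP => [y _ /= hy|/(_ x)/(_ h)//].
exact: abs_cvg_unique hy h.
Qed.

Lemma abs_cvg_near u w x N : (forall n, (N <= n)%N -> u n = w n) ->
  abs_cvg v u x -> abs_cvg v w x.
Proof.
move=> uw /abs_cvgP h; apply/abs_cvgP => e /h[M hM].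
exists (maxn N M) => n; rewrite geq_max => /andP[h1 h2].
by rewrite -uw// hM.
Qed.

Lemma abs_cvg_cst x : abs_cvg v (fun=> x) x.
Proof. by apply/abs_cvgP => e e0; exists 0%N => n _; rewrite subrr abs0. Qed.

Lemma abs_cvgD u w x y : abs_cvg v u x -> abs_cvg v w y ->
  abs_cvg v (fun n => u n + w n) (x + y).
Proof.
move=> /abs_cvgP h1 /abs_cvgP h2; apply/abs_cvgP => e e0.
have [N1 H1] := h1 _ e0; have [N2 H2] := h2 _ e0.
exists (maxn N1 N2) => n; rewrite geq_max => /andP[n1 n2].
rewrite (_ : u n + w n - (x + y) = (u n - x) + (w n - y)); last by ring.
by rewrite absD_lt ?H1 ?H2.
Qed.

Lemma abs_cvgM u w x y : abs_cvg v u x -> abs_cvg v w y ->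
  abs_cvg v (fun n => u n * w n) (x * y).
Proof.
move=> /abs_cvgP h1 /abs_cvgP h2; apply/abs_cvgP => e e0.
have x0 : 0 < v x + 1 by rewrite ltr_wpDl ?padic_abs_ge0.
have y0 : 0 < v y + 1 by rewrite ltr_wpDl ?padic_abs_ge0.
have [N1 H1] := h1 (e / (v y + 1)) (divr_gt0 e0 y0).
have [N2 H2] := h2 (e / (v x + 1)) (divr_gt0 e0 x0).
have [N3 H3] := h2 1 ltr01.
exists (maxn N1 (maxn N2 N3)) => n; rewrite !geq_max => /and3P[n1 n2 n3].
rewrite (_ : u n * w n - x * y = (u n - x) * w n + x * (w n - y)); last by ring.
have wy : v (w n) <= v y + 1.
  rewrite -(subrK y (w n)) absD_le//; last by rewrite lerDl.
  by rewrite (le_trans (ltW (H3 n n3)))// lerDr padic_abs_ge0.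
apply: absD_lt; rewrite padic_absM.
  rewrite (le_lt_trans (ler_wpM2l (padic_abs_ge0 _) wy))//.
  by rewrite -ltr_pdivlMr// H1.
rewrite (@le_lt_trans _ _ ((v x + 1) * v (w n - y)))//.
  by rewrite ler_wpM2r ?padic_abs_ge0// lerDl.
by rewrite mulrC -ltr_pdivlMr// H2.
Qed.

Lemma abs_cvg_sum (I : Type) (s : seq I) (P : pred I) (u : I -> nat -> Cp)
    (x : I -> Cp) : (forall i, P i -> abs_cvg v (u i) (x i)) ->
  abs_cvg v (fun n => \sum_(i <- s | P i) u i n) (\sum_(i <- s | P i) x i).
Proof.
move=> h; elim: s => [|i s IH].
  rewrite big_nil; rewrite (_ : (fun=> _) = fun=> 0); first exact: abs_cvg_cst.
  by apply/funext => n; rewrite big_nil.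
have -> : (fun n => \sum_(j <- i :: s | P j) u j n) =
    (fun n => if P i then u i n + \sum_(j <- s | P j) u j n else \sum_(j <- s | P j) u j n).
  by apply/funext => n; rewrite big_cons.
by rewrite big_cons; case: ifP => // Pi; apply: abs_cvgD => //; apply: h.
Qed.

Lemma padic_int_abs x : padic_int x -> v x <= 1.
Proof.
move=> /(_ 1 ltr01)[_ [a _ <-]] h.
by rewrite -(subrK a%:~R x) absD_le ?abs_int_le1// ltW.
Qed.

Lemma padic_int_int (a : int) : padic_int (a%:~R : Cp).
Proof. by move=> e e0; exists a%:~R; [exists a|rewrite subrr abs0]. Qed.

Lemma padic_int_nat k : padic_int (k%:R : Cp).
Proof. exact: (padic_int_int k). Qed.

Lemma padic_intD x y : padic_int x -> padic_int y -> padic_int (x + y).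
Proof.
move=> hx hy e e0; have [_ [a _ <-] ha] := hx e e0; have [_ [b _ <-] hb] := hy e e0.
exists (a + b)%:~R; first by exists (a + b).
rewrite intrD (_ : _ - _ = (x - a%:~R) + (y - b%:~R)); last by ring.
exact: absD_lt.
Qed.

Lemma padic_intM x y : padic_int x -> padic_int y -> padic_int (x * y).
Proof.
move=> hx hy e e0; have [_ [a _ <-] ha] := hx e e0; have [_ [b _ <-] hb] := hy e e0.
exists (a * b)%:~R; first by exists (a * b).
rewrite intrM (_ : _ - _ = y * (x - a%:~R) + a%:~R * (y - b%:~R)); last by ring.
apply: absD_lt; rewrite padic_absM.
  apply: le_lt_trans ha; rewrite ler_piMl ?padic_abs_ge0//; exact: padic_int_abs.
apply: le_lt_trans hb; rewrite ler_piMl ?padic_abs_ge0//; exact: abs_int_le1.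
Qed.

Lemma padic_intN x : padic_int x -> padic_int (- x).
Proof. by move=> h; rewrite -mulN1r; apply: padic_intM => //; exact: (padic_int_int (-1)). Qed.

Lemma padic_intB x y : padic_int x -> padic_int y -> padic_int (x - y).
Proof. by move=> hx hy; apply: padic_intD => //; exact: padic_intN. Qed.

Lemma padic_int_sum (I : Type) (s : seq I) (P : pred I) (F : I -> Cp) :
  (forall i, P i -> padic_int (F i)) -> padic_int (\sum_(i <- s | P i) F i).
Proof.
move=> h; elim/big_ind : _ => //; [exact: (padic_int_nat 0)|exact: padic_intD].
Qed.

Lemma padic_int_prod (I : Type) (s : seq I) (P : pred I) (F : I -> Cp) :
  (forall i, P i -> padic_int (F i)) -> padic_int (\prod_(i <- s | P i) F i).
Proof.
move=> h; elim/big_ind : _ => //; [exact: (padic_int_nat 1)|exact: padic_intM].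
Qed.

Lemma padic_intX x k : padic_int x -> padic_int (x ^+ k).
Proof.
move=> h; elim: k => [|k IH]; first exact: (padic_int_nat 1).
by rewrite exprS; exact: padic_intM.
Qed.

(** An inverse [a] of [k] modulo p^l, given by Bezout, is an integer within p^-l of 1/k. *)
Lemma padic_int_inv k : coprime k p -> padic_int (k%:R^-1 : Cp).
Proof.
move=> kp e /eps_arch[l le].
have k0 : (0 < k)%N.
  by case: k kp => //; rewrite /coprime gcd0n => /eqP p1; move: hp; rewrite p1.
case: (egcdnP (p ^ l) k0) => a b e1 _.
have kpl : gcdn k (p ^ l) = 1%N by apply/eqP; rewrite -/(coprime _ _) coprimeXr.
exists a%:R; first by exists (Posz a).
have kn0 : k%:R != 0 :> Cp by rewrite natCp_eq0 -lt0n.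
rewrite (_ : _ - _ = - (k%:R^-1 * (b%:R * p%:R ^+ l))); last first.
  rewrite -natrX -natrM.
  have -> : (b * p ^ l)%:R = a%:R * k%:R - 1 :> Cp.
    by rewrite -natrM e1 kpl natrD addrK.
  by field.
rewrite absN padic_absM absV abs_coprime// invr1 mul1r padic_absM abs_pX.
by apply: le_lt_trans le; rewrite ler_piMl ?eps_ge0 ?abs_nat_le1.
Qed.

(** The unit ball of C_p is larger than Z_p, so an absolute value alone does not express
    divisibility in Z_p. The point is that x / p^l is again a limit of integers: an integer close
    enough to x is itself divisible by p^l. *)
Lemma padic_dvdP l x : padic_dvd l x <-> padic_int x /\ v x <= eps l.
Proof.
have pn0 : p%:R ^+ l != 0 :> Cp by rewrite expf_neq0// natCp_eq0 -lt0n prime_gt0.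
split=> [[z hz ->]|[hx xl]].
  split; first by apply: padic_intM => //; apply: padic_intX; exact: padic_int_nat.
  by rewrite padic_absM abs_pX ler_piMr ?eps_ge0//; exact: padic_int_abs.
exists (x / p%:R ^+ l); last by field.
move=> e e0.
(* The factor [eps l] compensates the division by p^l; the cap at 1 makes |a| at most p^-l, so that
   p^l divides [a]. *)
pose e' := Num.min e 1 * eps l.
have e'0 : 0 < e' by rewrite mulr_gt0 ?eps_gt0// lt_min e0 ltr01.
have [_ [a _ <-] ha] := hx e' e'0.
have : v a%:~R <= eps l.
  rewrite -[a%:~R](subrK x) absD_le// absB_sym (le_trans (ltW ha))//.
  by rewrite /e' ler_piMl ?eps_ge0// ge_min lexx orbT.
rewrite abs_int_le => /dvdnP[b hb].
have [b' ab] : exists b' : int, a%:~R = b'%:~R * p%:R ^+ l :> Cp.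
  exists (sgz a * b%:Z); rewrite -natrX -[(p ^ l)%:R]/((p ^ l)%:Z%:~R) -intrM.
  by rewrite -mulrA -PoszM -hb -intEsg.
exists b'%:~R; first by exists b'.
rewrite (_ : _ - _ = (x - a%:~R) / p%:R ^+ l); last by rewrite ab; field.
rewrite padic_absM absV abs_pX ltr_pdivrMr ?eps_gt0//.
by rewrite (lt_le_trans ha)// /e' ler_pM2r ?eps_gt0// ge_min lexx.
Qed.

Lemma padic_int_approx x l : padic_int x -> exists b, v (x - b%:R) <= eps l.
Proof.
move=> /(_ _ (eps_gt0 l))[_ [a _ <-] /ltW ha].
case: a ha => k ha; first by exists k.
(* A natural number congruent to the negative integer -(k + 1) modulo p^l. *)
exists (k.+1 * (p ^ l).-1)%N.
rewrite -(subrK (Negz k)%:~R x) -addrA absD_le//.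
have -> : (Negz k)%:~R - (k.+1 * (p ^ l).-1)%:R = - (k.+1%:R * p%:R ^+ l) :> Cp.
  rewrite NegzE mulrNz natrM -natrX.
  by rewrite -[in RHS](prednK (_ : 0 < p ^ l)%N) ?expn_gt0 ?prime_gt0// -nat1r pmulrn; ring.
by rewrite absN padic_absM abs_pX ler_piMl ?eps_ge0 ?abs_nat_le1.
Qed.

Lemma abs_subX_le x y C k : v x <= 1 -> v y <= 1 -> v (x - y) <= C ->
  v (x ^+ k - y ^+ k) <= C.
Proof.
move=> x1 y1 h; have C0 := le_trans (padic_abs_ge0 _) h.
elim: k => [|k IH]; first by rewrite !expr0 subrr abs0.
rewrite (_ : _ - _ = x * (x ^+ k - y ^+ k) + y ^+ k * (x - y)); last first.
  by rewrite !exprS; ring.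
by rewrite absD_le ?absM_le1// absX exprn_ile1// padic_abs_ge0.
Qed.

(* Euler's theorem, transferred to Z_p by approximating x by natural numbers. *)
Lemma padic_euler x l (m n : nat) : (0 < l)%N ->
  padic_int x -> ~ padic_dvd 1 x ->
  m = n %[mod (p - 1) * p ^ (l - 1)] -> v (x ^+ m - x ^+ n) <= eps l.
Proof.
move=> l0 hx xu mn; have [b hb] := padic_int_approx l hx.
(* If p divided [b], then p would divide x as well, because l is positive. *)
have bp : coprime b p.
  rewrite coprime_sym prime_coprime//; apply/negP => pb; apply: xu.
  apply/padic_dvdP; split=> //; rewrite -(subrK b%:R x) absD_le//.
    by rewrite (le_trans hb)// eps_le.
  by rewrite abs_nat_le expn1.
have hX k : v (x ^+ k - b%:R ^+ k) <= eps l.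
  by apply: abs_subX_le => //; [exact: padic_int_abs|exact: abs_nat_le1].
rewrite (_ : _ - _ = (x ^+ m - b%:R ^+ m) + (b%:R ^+ m - b%:R ^+ n)
   - (x ^+ n - b%:R ^+ n)); last by ring.
rewrite absB_le// absD_le// -!natrX; apply: abs_eqmod.
have tot : totient (p ^ l) = ((p - 1) * p ^ (l - 1))%N.
  by rewrite totient_pfactor// !subn1.
rewrite -tot in mn.
have bE : b ^ totient (p ^ l) = 1 %[mod p ^ l] by rewrite Euler_exp_totient// coprimeXr.
have red k : b ^ k = b ^ (k %% totient (p ^ l)) %[mod p ^ l].
  rewrite {1}(divn_eq k (totient (p ^ l))) expnD (mulnC (_ %/ _)%N) expnM -modnMml.
  by rewrite -modnXm bE modnXm exp1n modnMml mul1n.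
by rewrite red mn -red.
Qed.

(** Telescoping: the factors are exchanged one at a time, the others having absolute value at most
    1. *)
Lemma abs_prod_sub_le (I : Type) (s : seq I) (F G : I -> Cp) C :
  0 <= C -> (forall i, v (F i) <= 1) -> (forall i, v (G i) <= 1) ->
  (forall i, v (F i - G i) <= C) ->
  v (\prod_(i <- s) F i - \prod_(i <- s) G i) <= C.
Proof.
move=> C0 F1 G1 FG; elim: s => [|i s IH]; first by rewrite !big_nil subrr abs0.
rewrite !big_cons (_ : _ - _ = F i * (\prod_(j <- s) F j - \prod_(j <- s) G j)
  + (\prod_(j <- s) G j) * (F i - G i)); last by ring.
rewrite absD_le ?absM_le1//; elim/big_ind : _ => //; first by rewrite abs1.
by move=> x y; exact: absM_le1.
Qed.

(** If |x| > C, a term closer to x than |x| contradicts the ultrametric inequality. This lemma and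
    the next carry congruences and integrality from Riemann sums to their limits. *)
Lemma abs_cvg_le u x C : (forall n, v (u n) <= C) -> abs_cvg v u x -> v x <= C.
Proof.
move=> uC /abs_cvgP h; rewrite leNgt; apply/negP => Cx.
have x0 : 0 < v x by rewrite (le_lt_trans _ Cx)// (le_trans _ (uC 0%N))// padic_abs_ge0.
have [N /(_ N (leqnn N)) hN] := h _ x0.
suff : v x < v x by rewrite ltxx.
by rewrite -{1}(subrK (u N) x) absD_lt// ?(le_lt_trans (uC N))// absB_sym.
Qed.

Lemma abs_cvg_padic_int u x : (forall n, padic_int (u n)) -> abs_cvg v u x -> padic_int x.
Proof.
move=> hu /abs_cvgP h e e0; have [N /(_ N (leqnn N)) hN] := h _ e0.
have [a ra ha] := hu N e e0; exists a => //.
by rewrite -(subrK (u N) x) -addrA absD_lt// absB_sym.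
Qed.

End PadicAbs.

(** * Sums over finite sets of families, and distributivity *)

Section FiniteSums.
Context (K : fieldType) (r : nat).

(** Passes to a finite index type, where the distributivity of iterated products over sums is
    available. *)
Lemma fsum_seq_sub (T : choiceType) (s : seq T) (A : set T) (F : T -> K) :
  A `<=` [set` s] ->
  \sum_(x \in A) F x = \sum_(x : seq_sub s | `[< A (ssval x) >]) F (ssval x).
Proof.
move=> As; rewrite (@bigfs _ _ _ _ _ (fun x : seq_sub s => `[< A (ssval x) >])) ?index_enum_uniq//.
  apply: reindex_fsbig; split.
  - by move=> x /= /asboolP.
  - by move=> x y _ _; exact: val_inj.
  - by move=> x Ax; exists (SeqSub (As _ Ax)) => //=; apply/asboolP.
by move=> x _; rewrite mem_index_enum.
Qed.

Let ffun_val (T : choiceType) (s : seq T) (f : {ffun 'I_r -> seq_sub s}) : {ffun 'I_r -> T} :=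
  [ffun i => ssval (f i)].

Lemma ffun_valP (T : choiceType) (A : 'I_r -> set T) : (forall i, finite_set (A i)) ->
  exists2 s : seq T, (forall i, A i `<=` [set` s]) &
  set_bij [set f : {ffun 'I_r -> seq_sub s} | forall i, A i (ssval (f i))]
    [set f : {ffun 'I_r -> T} | forall i, A i (f i)] (@ffun_val T s).
Proof.
(* One list containing the elements of all the [A i], so that families take values in a single
   finite type. *)
move=> Afin; pose s := flatten [seq finmap.enum_fset (fset_set (A i)) | i <- enum 'I_r].
have As i : A i `<=` [set` s].
  move=> x Ax; apply/flatten_mapP; exists i; first by rewrite mem_enum.
  by rewrite in_fset_set// inE.
exists s => //; split.
- by move=> f /= h i; rewrite ffunE.
- move=> f g _ _ /ffunP h; apply/ffunP => i; apply: val_inj.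
  by have := h i; rewrite !ffunE.
- move=> f /= h; exists [ffun i => SeqSub (As i _ (h i))].
    by move=> i /=; rewrite ffunE.
  by apply/ffunP => i; rewrite !ffunE.
Qed.

Lemma finite_set_ffun (T : choiceType) (A : 'I_r -> set T) : (forall i, finite_set (A i)) ->
  finite_set [set f : {ffun 'I_r -> T} | forall i, A i (f i)].
Proof.
move=> /ffun_valP[s _ [_ _ h]].
apply: sub_finite_set h _; apply: finite_image.
exact: (@sub_finite_set _ _ setT).
Qed.

Lemma fsum_ffun_prod (T : choiceType) (A : 'I_r -> set T) (F : 'I_r -> T -> K) :
  (forall i, finite_set (A i)) ->
  \sum_(f \in [set f : {ffun 'I_r -> T} | forall i, A i (f i)]) \prod_i F i (f i) =
  \prod_i \sum_(x \in A i) F i x.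
Proof.
move=> /ffun_valP[s As hbij].
rewrite (@reindex_fsbig _ _ _ _ _ _ _ _ (fun f : {ffun _ -> _} => \prod_i F i (f i)) hbij).
under [RHS]eq_bigr => i _ do rewrite (fsum_seq_sub _ (As i)).
rewrite bigA_distr_big_dep [RHS](@bigfs _ _ _ _ _ _) ?index_enum_uniq//; last first.
  by move=> x _; rewrite mem_index_enum.
apply/esym; rewrite (_ : [set` _] = [set f : {ffun 'I_r -> seq_sub s} | forall i, A i (ssval (f i))]).
  by apply: eq_fsbigr => f _; apply: eq_bigr => i _; rewrite ffunE.
apply/seteqP; split=> f /=.
  by move=> /familyP h i; apply/asboolP; exact: h.
by move=> h; apply/familyP => i; apply/asboolP; exact: h.
Qed.

End FiniteSums.

(** * Roots of unity, integrality of the measure, and characters of Z/pZ *)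

Section RootsOfUnity.
Context (R : realType) (p : nat) (Cp : padicComplexType R p).
Hypothesis hp : prime p.
Local Notation v := (padic_abs : Cp -> R).
Implicit Types (x y g : Cp) (k l : nat).

Definition unity_roots k : set Cp := [set x | x ^+ k = 1].

Lemma finite_unity_roots k : (0 < k)%N -> finite_set (unity_roots k).
Proof.
move=> k0; have [s hs] := closed_field_poly_normal ('X^k - 1 : {poly Cp}).
apply: (@sub_finite_set _ _ [set` s]); last exact: finite_seq.
move=> x /= xk; have : root ('X^k - 1) x by rewrite rootE !hornerE xk subrr.
by rewrite hs lead_coefXnsubC// scale1r root_prod_XsubC.
Qed.

Lemma finite_nontriv_roots k : (0 < k)%N -> finite_set (nontriv_roots k : set Cp).
Proof.
by move=> k0; apply: sub_finite_set (finite_unity_roots k0) => x [].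
Qed.

Lemma unity_root_coprime x k l : coprime k l -> x ^+ k = 1 -> x ^+ l = 1 -> x = 1.
Proof.
move=> kl xk xl; have [k0|k0] := posnP k.
  by move: kl xl; rewrite k0 /coprime gcd0n => /eqP ->.
case: (egcdnP l k0) => a b e _; move: kl; rewrite /coprime => /eqP kl.
have := congr1 (fun q : nat => x ^+ q) e.
by rewrite kl exprD mulnC [(b * _)%N]mulnC !exprM xk xl !expr1n mul1r expr1.
Qed.

(** Either x -> x^j is trivial on the group and the sum counts its elements, or some z has z^j <> 1;
    then multiplication by z permutes the roots and the sum S satisfies (1 - z^j) S = 0. *)
Lemma sum_unity_roots_int k (j : nat) : (0 < k)%N ->
  exists a : int, \sum_(x \in unity_roots k) x ^+ j = a%:~R.
Proof.
move=> k0; have Afin := finite_unity_roots k0.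
case: (pselect (forall x, unity_roots k x -> x ^+ j = 1)) => [h|].
  exists (Posz (size (finmap.enum_fset (fset_set (unity_roots k))))).
  rewrite (@eq_fsbigr _ _ _ _ _ (fun=> 1)) => [|x]; last first.
    by rewrite inE; exact: h.
  by rewrite fsbig_finite//= big_const_seq count_predT iter_addr_0 -pmulrn.
move=> /existsNP[z /not_implyP[zk zj]]; exists 0.
have z0 : z != 0.
  apply/eqP => z0; move: zk; rewrite /unity_roots /= z0 expr0n gtn_eqF// => /eqP.
  by rewrite eq_sym oner_eq0.
set S := \sum_(x \in _) _.
suff : (1 - z ^+ j) * S = 0.
  move=> /eqP; rewrite mulf_eq0 => /orP[|/eqP ->//].
  by rewrite subr_eq0 eq_sym => /eqP.
rewrite mulrBl mul1r /S mulr_fsumr.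
rewrite {1}(@reindex_fsbig _ _ _ _ _ ( *%R z) (unity_roots k)).
  by under eq_fsbigr do rewrite exprMn; rewrite subrr.
split.
- by move=> x /=; rewrite /unity_roots /= exprMn zk => ->; rewrite mulr1.
- by move=> x y _ _; exact: mulfI.
- move=> x /= xk; exists (z^-1 * x); last by rewrite mulrA divff// mul1r.
  by rewrite /unity_roots /= exprMn exprVn zk xk invr1 mulr1.
Qed.

Lemma sum_nontriv_roots_int k (j : nat) : (0 < k)%N ->
  exists a : int, \sum_(x \in (nontriv_roots k : set Cp)) x ^+ j = a%:~R.
Proof.
move=> k0; have [a ha] := sum_unity_roots_int j k0; exists (a - 1).
rewrite intrB -ha (@fsbigD1 _ _ _ _ 1 (unity_roots k)); last 2 first.
- exact: (finite_unity_roots k0).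
- by rewrite /unity_roots /= expr1n.
rewrite /= expr1n addrC addrK; apply: eq_fsbigl.
by apply/seteqP; split=> x.
Qed.

Lemma sum_arith_geom x k :
  (1 - x) * \sum_(i < k) i%:R * x ^+ i = x * \sum_(i < k) x ^+ i - k%:R * x ^+ k.
Proof.
elim: k => [|k IH]; first by rewrite !big_ord0 !mulr0 mul0r subrr.
by rewrite !big_ord_recr /= !mulrDr IH -nat1r exprS; ring.
Qed.

Lemma sum_geom_root x k : x ^+ k = 1 -> x <> 1 -> \sum_(i < k) x ^+ i = 0.
Proof.
move=> xk x1; have := subrX1 x k; rewrite xk subrr => /esym/eqP.
by rewrite mulf_eq0 subr_eq0 => /orP[/eqP|/eqP].
Qed.

(** For x^k = 1, [sum_arith_geom] reads (1 - x) sum_i i x^i = -k. The inverse thus becomes a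
    polynomial in x whose only denominator is k, a p-adic unit when k is prime to p. *)
Lemma inv_1sub_root x k : (0 < k)%N -> x ^+ k = 1 -> x <> 1 ->
  (1 - x)^-1 = - (k%:R^-1 * \sum_(i < k) i%:R * x ^+ i).
Proof.
move=> k0 xk x1.
have n1 : 1 - x != 0 by rewrite subr_eq0 eq_sym; apply/eqP.
have kn0 : k%:R != 0 :> Cp by rewrite natCp_eq0 // -lt0n.
apply: (mulfI n1); rewrite divff// mulrN mulrCA sum_arith_geom sum_geom_root//.
by rewrite xk; field.
Qed.

Lemma abs_inv_1sub_root x k : (0 < k)%N -> coprime k p -> x ^+ k = 1 -> x <> 1 ->
  v (1 - x)^-1 <= 1.
Proof.
move=> k0 kp xk x1; rewrite (inv_1sub_root k0)// absN absM_le1//.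
  by apply: padic_int_abs; exact: padic_int_inv.
apply: abs_sum_le => // i _; apply: absM_le1; first exact: abs_nat_le1.
by rewrite absX (abs_unity_root k0 xk) expr1n.
Qed.

(** Since c is prime to p, x^(p^N) is again a nontrivial c-th root of unity. By [inv_1sub_root] the
    measure is 1/c times an integral combination of power sums over nontrivial roots, and these are
    integers. *)
Lemma padic_int_koblitz_sum c N j : (0 < c)%N -> coprime c p ->
  padic_int (koblitz_sum Cp c N j).
Proof.
move=> c0 cp; rewrite /koblitz_sum.
have cfin := finite_nontriv_roots c0.
rewrite (@eq_fsbigr _ _ _ _ _ (fun x => - c%:R^-1 * \sum_(i < c) i%:R * x ^+ (j + p ^ N * i))); last first.
  move=> x; rewrite inE => -[xc x1]; rewrite /koblitz (@inv_1sub_root _ c)//.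
  - rewrite mulrN mulNr; congr (- _); rewrite mulrCA mulr_sumr.
    congr (_ * _); apply: eq_bigr => i _.
    by rewrite mulrCA exprD exprM.
  - by rewrite exprAC xc expr1n.
  - by move=> xp; apply: x1; apply: (@unity_root_coprime _ c (p ^ N)); rewrite ?coprimeXr.
rewrite -mulr_fsumr; apply: padic_intM.
  by apply: padic_intN; exact: padic_int_inv.
rewrite fsbig_finite// exchange_big /=; apply: padic_int_sum => i _.
rewrite -mulr_sumr -fsbig_finite//; apply: padic_intM; first exact: padic_int_nat.
by have [a ->] := sum_nontriv_roots_int (j + p ^ N * i) c0; exact: padic_int_int.
Qed.

(** A root of 1 + X + ... + X^(p-1) has order dividing p; order 1 would give p = 0. *)
Lemma prim_root_p_exists : exists z : Cp, p.-primitive_root z.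
Proof.
have p1 := prime_gt1 hp.
have /closed_rootP[z hz] : size (\poly_(i < p) 1 : {poly Cp}) != 1.
  by rewrite size_poly_eq ?oner_eq0// gtn_eqF.
have sz : \sum_(i < p) z ^+ i = 0.
  move: hz; rewrite rootE horner_poly => /eqP h; rewrite -[RHS]h.
  by apply: eq_bigr => i _; rewrite mul1r.
have zp : z ^+ p = 1 by apply/eqP; rewrite -subr_eq0 subrX1 sz mulr0.
have [m mz mp] := prim_order_exists (prime_gt0 hp) zp.
have /orP[/eqP m1|/eqP mE] := (primeP hp).2 m mp; last by rewrite mE in mz; exists z.
have z1 : z = 1 by have := prim_expr_order mz; rewrite m1 expr1.
have := sz; rewrite z1; under eq_bigr do rewrite expr1n.
by rewrite sumr_const card_ord => /eqP; rewrite natCp_eq0 // gtn_eqF ?prime_gt0.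
Qed.

Lemma fsum_unity_roots_p (z : Cp) (F : Cp -> Cp) : p.-primitive_root z ->
  \sum_(x \in unity_roots p) F x = \sum_(i < p) F (z ^+ i).
Proof.
move=> zp; rewrite (@fsbigE _ _ _ _ (unity_roots p) [seq z ^+ i | i : 'I_p <- enum 'I_p]).
- rewrite big_map big_enum_cond; apply: eq_bigl => i; rewrite /= mem_set//.
  by rewrite /unity_roots /= exprAC (prim_expr_order zp) expr1n.
- rewrite map_inj_in_uniq ?enum_uniq// => i j _ _ /eqP.
  by rewrite (eq_prim_root_expr zp) !modn_small// => /eqP /val_inj.
- by move=> x /mapP[i _ ->]; rewrite /unity_roots /= exprAC (prim_expr_order zp) expr1n.
- move=> x xp /negP[]; have [i ->] := prim_rootP zp xp.
  by apply: map_f; rewrite mem_enum.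
Qed.

(** The chosen exponent depends on [g] alone, so one integer serves all [rho] at once;
    [root_pow_prod] rests on this. *)
Lemma root_pow_intP (g : Cp) : padic_int g ->
  exists a : int, padic_dvd 1 (g - a%:~R) /\ (forall rho : Cp, root_pow rho g = rho ^ a).
Proof.
move=> hg; rewrite /root_pow; case: xgetP => [a _ ha|no]; first by exists a.
have [b hb] := padic_int_approx hp 1 hg; case: (no (Posz b)) => /=.
apply/padic_dvdP => //; split=> //; apply: padic_intB => //; exact: padic_int_nat.
Qed.

Lemma padic_dvd_int (a : int) : padic_dvd 1 (a%:~R : Cp) <-> (p %| `|a|)%N.
Proof.
rewrite padic_dvdP // abs_int_le // expn1; split=> [[]//|]; split=> //.
exact: padic_int_int.
Qed.

Lemma unity_root_dvd (rho : Cp) (a : int) : rho ^+ p = 1 -> (p %| `|a|)%N -> rho ^ a = 1.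
Proof.
move=> rp pa; have /dvdzP[b ->] : (p %| a)%Z by rewrite dvdzE.
by rewrite mulrC -exprz_exp -exprnP rp exp1rz.
Qed.

Lemma padic_dvdB l x y : padic_dvd l x -> padic_dvd l y -> padic_dvd l (x - y).
Proof.
rewrite !padic_dvdP // => -[hx vx] [hy vy]; split; last exact: absB_le.
exact: padic_intB.
Qed.

Lemma unity_root_neq0 (rho : Cp) k : (0 < k)%N -> rho ^+ k = 1 -> rho != 0.
Proof.
by move=> k0 rp; rewrite -padic_abs_eq0 (abs_unity_root k0 rp) oner_eq0.
Qed.

(** Two integers representing [g] modulo p differ by a multiple of p, which rho^p = 1 makes
    harmless. *)
Lemma root_powE (rho g : Cp) (b : int) : rho ^+ p = 1 -> padic_int g ->
  padic_dvd 1 (g - b%:~R) -> root_pow rho g = rho ^ b.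
Proof.
move=> rp hg hb; have [a [ha ->]] := root_pow_intP hg.
have r0 := unity_root_neq0 (prime_gt0 hp) rp.
rewrite -[b](subrK a) (expfzDr _ _ r0).
suff h : padic_dvd 1 ((b - a)%:~R : Cp).
  by move/padic_dvd_int: h => h; rewrite (unity_root_dvd rp h) mul1r.
rewrite intrB (_ : _ - _ = (g - a%:~R) - (g - b%:~R)); last by ring.
exact: padic_dvdB.
Qed.

Lemma root_powD (rho g h : Cp) : rho ^+ p = 1 -> padic_int g -> padic_int h ->
  root_pow rho (g + h) = root_pow rho g * root_pow rho h.
Proof.
move=> rp hg hh; have [a [ha ->]] := root_pow_intP hg.
have [b [hb ->]] := root_pow_intP hh.
rewrite -expfzDr ?(unity_root_neq0 (prime_gt0 hp) rp)//.
apply: root_powE => //; first exact: padic_intD.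
rewrite intrD (_ : _ - _ = (g - a%:~R) - (b%:~R - h)); last by ring.
apply: padic_dvdB => //; rewrite -opprB -sub0r; apply: padic_dvdB => //.
by rewrite padic_dvdP // abs0 eps_ge0; split=> //; exact: (padic_int_nat _ 0).
Qed.

Lemma root_pow0 (rho : Cp) : rho ^+ p = 1 -> root_pow rho 0 = 1.
Proof.
move=> rp; rewrite (@root_powE _ _ 0) ?expr0z//; first exact: (padic_int_nat _ 0).
rewrite subr0 padic_dvdP // abs0 eps_ge0; split=> //; exact: (padic_int_nat _ 0).
Qed.

Lemma root_powMn (rho g : Cp) (k : nat) : rho ^+ p = 1 -> padic_int g ->
  root_pow rho (k%:R * g) = root_pow rho g ^+ k.
Proof.
move=> rp hg; elim: k => [|k IH]; first by rewrite mul0r root_pow0.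
rewrite -nat1r mulrDl mul1r root_powD// ?IH ?exprS//.
by apply: padic_intM => //; exact: padic_int_nat.
Qed.

Lemma root_pow_sum (rho : Cp) (I : Type) (s : seq I) (P : pred I) (F : I -> Cp) :
  rho ^+ p = 1 -> (forall i, padic_int (F i)) ->
  root_pow rho (\sum_(i <- s | P i) F i) = \prod_(i <- s | P i) root_pow rho (F i).
Proof.
move=> rp hF; elim: s => [|i s IH]; first by rewrite !big_nil root_pow0.
rewrite !big_cons; case: ifP => // Pi.
by rewrite root_powD// ?IH//; apply: padic_int_sum.
Qed.

Lemma root_pow_prod (g : Cp) (I : Type) (s : seq I) (P : pred I) (F : I -> Cp) :
  padic_int g ->
  root_pow (\prod_(i <- s | P i) F i) g = \prod_(i <- s | P i) root_pow (F i) g.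
Proof.
move=> hg; have [a [_ h]] := root_pow_intP hg; rewrite h.
under [RHS]eq_bigr do rewrite h.
elim: s => [|i s IH]; first by rewrite !big_nil exp1rz.
by rewrite !big_cons; case: ifP => // Pi; rewrite expfzMl IH.
Qed.

Lemma root_pow1 (g : Cp) : padic_int g -> root_pow 1 g = 1.
Proof. by move=> /root_pow_intP[a [_ ->]]; rewrite exp1rz. Qed.

Lemma root_pow_unity (rho g : Cp) : rho ^+ p = 1 -> padic_int g ->
  root_pow rho g ^+ p = 1.
Proof.
move=> rp /root_pow_intP[a [_ ->]].
by rewrite exprnP exprz_exp mulrC -exprz_exp -exprnP rp exp1rz.
Qed.

(* Orthogonality of the characters of Z/pZ. *)
Lemma padic_unit_indicator (g : Cp) : padic_int g ->
  1 - p%:R^-1 * \sum_(rho \in unity_roots p) root_pow rho g =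
  if `[< padic_dvd 1 g >] then 0 else 1.
Proof.
move=> hg; have [z zp] := prim_root_p_exists.
rewrite (fsum_unity_roots_p _ zp).
have pn0 : p%:R != 0 :> Cp by rewrite natCp_eq0 // -lt0n prime_gt0.
have [a [ha ra]] := root_pow_intP hg.
have zip (i : nat) : (z ^+ i) ^+ p = 1 by rewrite exprAC (prim_expr_order zp) expr1n.
have aE : padic_dvd 1 g <-> (p %| `|a|)%N.
  rewrite -padic_dvd_int; split=> h.
    by rewrite (_ : a%:~R = g - (g - a%:~R)); [exact: padic_dvdB|ring].
  (* Here a - (a + a) is just -a: [g] is written as a difference of two multiples of p. *)
  rewrite (_ : g = (g - a%:~R) - (a%:~R - (a%:~R + a%:~R))); last by ring.
  apply: padic_dvdB => //; rewrite opprD addrA subrr sub0r -mulrNz.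
  by apply/padic_dvd_int; rewrite abszN; apply/padic_dvd_int.
under eq_bigr => i _ do rewrite ra.
case: asboolP => [/aE pa|pg].
  under eq_bigr => i _ do rewrite unity_root_dvd//.
  by rewrite sumr_const card_ord mulVf// subrr.
pose w := z ^ a.
rewrite (eq_bigr (fun i : 'I_p => w ^+ i)); last first.
  by move=> i _; rewrite /w !exprnP !exprz_exp mulrC.
rewrite sum_geom_root ?mulr0 ?subr0//.
  by rewrite /w exprnP exprz_exp mulrC -exprz_exp -exprnP (prim_expr_order zp) exp1rz.
move=> w1; apply: pg; apply/aE; rewrite (prim_order_dvd zp).
move: w1; rewrite /w; case: (a) => k; first by rewrite -exprnP => ->.
by rewrite NegzE -exprnN => /eqP; rewrite invr_eq1.
Qed.

End RootsOfUnity.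

(** * Riemann sums of moments and their limits *)

Section Moments.
Context (R : realType) (p : nat) (Cp : padicComplexType R p) (r : nat).
Hypothesis hp : prime p.
Local Notation v := (padic_abs : Cp -> R).
Local Notation mps := (mps Cp r).
Implicit Types (gam z : 'I_r -> Cp) (m : 'I_r -> nat).

Definition mps_cvg (f : nat -> mps) (g : mps) : Prop :=
  forall n, abs_cvg v (fun N => f N n) (g n).

Lemma mps_cvgM (f g : nat -> mps) (f' g' : mps) : mps_cvg f f' -> mps_cvg g g' ->
  mps_cvg (fun N => f N * g N) (f' * g').
Proof.
move=> ff gg n; rewrite mpsM (mps_mulE _ _ (@ltn_expo_sum _ n)).
under eq_fun => N do rewrite mpsM (mps_mulE _ _ (@ltn_expo_sum _ n)).
apply: abs_cvg_sum => a _; apply: abs_cvg_sum => b _.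
by apply: abs_cvgM => //; [exact: abs_cvg_cst|exact: abs_cvgM].
Qed.

Lemma mps_cvg_cst (f : mps) : mps_cvg (fun=> f) f.
Proof. by move=> n; exact: abs_cvg_cst. Qed.

Lemma mps_cvg_prod (I : Type) (s : seq I) (f : I -> nat -> mps) (g : I -> mps) :
  (forall i, mps_cvg (f i) (g i)) ->
  mps_cvg (fun N => \prod_(i <- s) f i N) (\prod_(i <- s) g i).
Proof.
move=> h; elim: s => [|i s IH].
  rewrite big_nil; under eq_fun => N do rewrite big_nil.
  exact: mps_cvg_cst.
rewrite big_cons; under eq_fun => N do rewrite big_cons.
exact: mps_cvgM.
Qed.

(* Coefficients of gam_j (t_j + ... + t_r). *)
Definition tail_form gam (j i : 'I_r) : Cp := if (j <= i)%N then gam j else 0.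

Definition tail_exp gam j : mps := mexp (tail_form gam j).

(** For E = exp(L), the level-N Riemann sum of the integral of E^x against the measure m_z. *)
Definition koblitz_gen (N : nat) (z : Cp) (E : mps) : mps :=
  \sum_(a < p ^ N) mpsC (koblitz z N a) * E ^+ a.

Lemma koblitz_genE N (z : Cp) (E : mps) : z ^+ (p ^ N) != 1 ->
  (1 - mpsC z * E) * koblitz_gen N z E =
  mpsC (1 - z ^+ (p ^ N))^-1 * (1 - mpsC (z ^+ (p ^ N)) * E ^+ (p ^ N)).
Proof.
move=> zN; rewrite /koblitz_gen.
have -> : \sum_(a < p ^ N) mpsC (koblitz z N a) * E ^+ a =
    mpsC (1 - z ^+ (p ^ N))^-1 * \sum_(a < p ^ N) (mpsC z * E) ^+ a.
  rewrite mulr_sumr; apply: eq_bigr => a _.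
  by rewrite /koblitz mulrC mpsCM mpsCX exprMn; ring.
rewrite mpsCX -exprMn mulrCA; congr (_ * _).
by rewrite -[RHS]opprB subrX1 -[RHS]mulNr opprB.
Qed.

(** The power is exp(p^N L), whose coefficient at [n] contains p^(N deg n); this tends to 0 except
    in degree 0. *)
Lemma mps_cvg_expX (b : 'I_r -> Cp) : mps_cvg (fun N => mexp b ^+ (p ^ N)) 1.
Proof.
move=> n; under eq_fun => N do rewrite (mexpX (natCp_eq0 Cp hp)).
have E N : mexp (fun i => (p ^ N)%:R * b i) n = (p%:R ^+ N) ^+ expo_deg n * mexp b n.
  rewrite /mexp /expo_deg -prodrXr -big_split; apply: eq_bigr => i _.
  by rewrite /= natrX exprMn mulrA.
under eq_fun => N do rewrite E.
have [n0|nn0] := eqVneq (expo_deg n) 0%N.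
  apply: (@abs_cvg_near _ _ _ (fun=> (1 : mps) n) _ _ 0%N); last exact: abs_cvg_cst.
  move=> N _; rewrite n0 expr0 mul1r (expo_deg0 n0) /mexp mps1 /mps_one eqxx big1// => i _.
  by rewrite ffunE expr0 fact0 divr1.
have -> : (1 : mps) n = 0.
  rewrite mps1 /mps_one; have [e|//] := eqVneq.
  by case/eqP: nn0; rewrite e /expo_deg big1// => i _; rewrite ffunE.
suff : abs_cvg v (fun N => (p%:R ^+ N) ^+ expo_deg n * mexp b n) (0 * mexp b n).
  by rewrite mul0r.
apply: abs_cvgM; last exact: abs_cvg_cst.
apply/abs_cvgP => e e0; have [l le] := eps_arch hp e0; exists l => N lN.
rewrite subr0 -exprM abs_pX; apply: le_lt_trans le; rewrite eps_le //.
by rewrite (leq_trans lN)// leq_pmulr// lt0n.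
Qed.

Lemma koblitz_gen_cvg (z : Cp) (b : 'I_r -> Cp) : z != 1 ->
  (forall N, (0 < N)%N -> z ^+ (p ^ N) <> 1 /\ v (1 - z ^+ (p ^ N))^-1 <= 1) ->
  mps_cvg (fun N => koblitz_gen N.+1 z (mexp b)) (mps_inv (1 - mpsC z * mexp b : mps)).
Proof.
move=> z1 hz; set u : mps := 1 - mpsC z * mexp b.
have u0 : u [ffun=> 0%N] != 0.
  rewrite /u mpsD mpsN mpsCE mps1 /mps_one eqxx /mexp big1 => [|i _]; last first.
    by rewrite ffunE expr0 fact0 divr1.
  by rewrite mulr1 subr_eq0 eq_sym.
have uV := mps_invP u0; set H : mps := mps_inv u in uV *.
have GE N : koblitz_gen N.+1 z (mexp b) = H *
   (mpsC (1 - z ^+ (p ^ N.+1))^-1 * (1 - mpsC (z ^+ (p ^ N.+1)) * mexp b ^+ (p ^ N.+1))).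
  have [/eqP zN _] := hz N.+1 isT.
  by rewrite -koblitz_genE// mulrA (mulrC H) uV mul1r.
under eq_fun => N do rewrite GE.
set w := fun N => z ^+ (p ^ N.+1).
have D : mps_cvg (fun N => mpsC (1 - w N)^-1 * (1 - mpsC (w N) * mexp b ^+ (p ^ N.+1))) 1.
  move=> n.
  (* The numbers 1/(1 - w_N) need not converge. In this form they only multiply a null sequence, and
     their boundedness suffices. *)
  have E N : (mpsC (1 - w N)^-1 * (1 - mpsC (w N) * mexp b ^+ (p ^ N.+1))) n =
      (1 : mps) n + ((1 - w N)^-1 - 1) * ((1 : mps) n - (mexp b ^+ (p ^ N.+1) : mps) n).
    have [wN _] := hz N.+1 isT.
    have w1 : 1 - w N != 0 by rewrite subr_eq0 eq_sym; apply/eqP.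
    by rewrite mpsCE mpsD mpsN mpsCE; field.
  under eq_fun => N do rewrite E.
  apply/abs_cvgP => e e0; have /abs_cvgP h := @mps_cvg_expX b n.
  have [M hM] := h _ e0; exists M => N MN; rewrite addrC addKr.
  apply: le_lt_trans (hM N.+1 (leqW MN)); rewrite absM_le1//.
    by rewrite absB_le ?abs1//; have [] := hz N.+1 isT.
  by rewrite absB_sym.
by have := mps_cvgM (mps_cvg_cst H) D; rewrite mulr1.
Qed.

Lemma twisted_genE z gam : twisted_gen z gam =
  \prod_j (mps_inv (1 - mpsC (z j) * tail_exp gam j : mps) : mps).
Proof.
rewrite /twisted_gen.
have e j : (fun n => mps_one Cp n - z j *
    mps_exp (fun n' => gam j * \sum_(k < r | (j <= k)%N) mps_var Cp k n') n) =
    1 - mpsC (z j) * tail_exp gam j :> mps.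
  apply/funext => n; rewrite mpsD mpsN mpsCE; congr (_ - _ * _).
  rewrite /tail_exp -(mps_expE (natCp_eq0 Cp hp)); congr (mps_exp _ n).
  apply/funext => n'; rewrite mulr_sumr big_mkcond; apply: eq_bigr => k _.
  by rewrite /tail_form; case: ifP => // _; rewrite mul0r.
(* The iterated convolution of [twisted_gen] is convertible to the product in the ring [mps]. *)
by apply: (@eq_bigr (mpseries Cp r) (@mps_one Cp r) (@mps_mul Cp r)) => j _; rewrite -e.
Qed.

Definition riemann_moment gam m (N : nat) z : Cp :=
  \sum_(a : {ffun 'I_r -> 'I_(p ^ N)})
    (\prod_i partial_form gam (fun j => (a j)%:R) i ^+ m i) *
    \prod_j koblitz (z j) N (a j).

(** Expanding the product selects one a_j per factor and gives exp(sum_j a_j gam_j (t_j + ... +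
    t_r)). Collected by variables, the coefficient of t_i in this exponent is the i-th partial form,
    and the factorials cancel. *)
Lemma riemann_momentE gam m N z :
  riemann_moment gam m N z =
  (\prod_j koblitz_gen N (z j) (tail_exp gam j)) (finfun m) * \prod_j (m j)`!%:R.
Proof.
rewrite bigA_distr_bigA mps_sum mulr_suml; apply: eq_bigr => a _.
rewrite [X in _ = X _ * _]big_split /=.
have -> : \prod_j @mpsC Cp r (koblitz (z j) N (a j)) = mpsC (\prod_j koblitz (z j) N (a j)).
  exact/esym/(big_morph (@mpsC Cp r) (@mpsCM Cp r) (@mpsC1 Cp r)).
have -> : \prod_j tail_exp gam j ^+ a j =
    mexp (fun i => \sum_j (a j)%:R * tail_form gam j i).
  rewrite -(mexp_prod (natCp_eq0 Cp hp)); apply: eq_bigr => j _.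
  by rewrite /tail_exp (mexpX (natCp_eq0 Cp hp)).
rewrite mpsCE mulrC -mulrA; congr (_ * _).
rewrite /mexp -big_split; apply: eq_bigr => i _ /=.
rewrite ffunE -mulrA mulVf ?mulr1; last by rewrite natCp_eq0 // -lt0n fact_gt0.
congr (_ ^+ _); rewrite /partial_form big_mkcond; apply: eq_bigr => j _.
by rewrite /tail_form; case: ifP => // _; rewrite mulr0.
Qed.

Lemma riemann_moment_cvg gam m z : (forall j, z j != 1) ->
  (forall j N, (0 < N)%N -> z j ^+ (p ^ N) <> 1 /\ v (1 - z j ^+ (p ^ N))^-1 <= 1) ->
  abs_cvg v (fun N => riemann_moment gam m N.+1 z) (twisted_bernoulli m z gam).
Proof.
move=> z1 hz; rewrite /twisted_bernoulli.
under eq_fun => N do rewrite riemann_momentE.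
apply: abs_cvgM; last exact: abs_cvg_cst.
rewrite twisted_genE; apply: (@mps_cvg_prod _ _ (fun j N => _)) => j.
by apply: koblitz_gen_cvg => // N N0; exact: hz.
Qed.

End Moments.

(** * Powers with natural exponents and the Teichmueller factorisation *)

Section PadicPowers.
Context (R : realType) (p : nat) (Cp : padicComplexType R p).
Hypothesis hp : prime p.
Local Notation v := (padic_abs : Cp -> R).

Lemma prod_sub_ffact (K : comNzRingType) (n k : nat) :
  \prod_(i < k) (n%:R - i%:R) = (n ^_ k)%:R :> K.
Proof.
elim: k => [|k IH]; first by rewrite big_ord0 ffactn0.
rewrite big_ord_recr /= IH ffactnSr natrM.
(* Truncated subtraction is wrong for k > n, but there the falling factorial is already 0. *)
have [kn|nk] := leqP k n; first by rewrite natrB.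
by rewrite ffact_small// !mul0r.
Qed.

(** For s = n the binomial series is a finite sum, so its partial sums are constant from n + 1 terms
    on. *)
Lemma padic_pow_nat (u : Cp) (n : nat) : padic_pow u n%:R = u ^+ n.
Proof.
rewrite /padic_pow; apply: padic_limE.
apply: (@abs_cvg_near _ _ _ (fun=> u ^+ n) _ _ n.+1); last exact: abs_cvg_cst.
move=> N nN; rewrite /series /= big_mkord -{1}(subrK 1 u) addrC exprDn.
rewrite (big_ord_widen _ (fun i => 1 ^+ (n - i) * (u - 1) ^+ i *+ 'C(n, i)) nN).
rewrite big_mkcond; apply: eq_bigr => i _ /=.
rewrite prod_sub_ffact -bin_ffact natrM mulfK; last first.
  by rewrite natCp_eq0 // -lt0n fact_gt0.
rewrite ltnS; case: leqP => [_|ni]; first by rewrite expr1n mul1r mulr_natl.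
by rewrite bin_small// mul0r.
Qed.

(** Holds for the default value 1 of [xget] as well, so [angle x * teich x] is [x] for every [x]. *)
Lemma teich_neq0 (x : Cp) : teich x != 0.
Proof.
rewrite /teich; case: xgetP => [w _ [hw _]|_]; last exact: oner_neq0.
move: hw; rewrite /padic_W; case: ifPn => [_ [->|->]|p2 [_ /unity_root_neq0]].
- exact: oner_neq0.
- by rewrite oppr_eq0 oner_neq0.
- by apply; have := prime_gt1 hp; lia.
Qed.

(** The double sign comes from inserting s = -n in [padic_mult_L]. *)
Lemma angle_teich_pow (x : Cp) (n : nat) :
  padic_pow (angle x) (- - n%:R) * teich x ^ n%:Z = x ^+ n.
Proof. by rewrite opprK padic_pow_nat -exprnP -exprMn /angle divfK// teich_neq0. Qed.

End PadicPowers.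

(** * Riemann sums of the p-adic L-function, their limit and their congruences *)

Section RiemannSums.
Context (R : realType) (p : nat) (Cp : padicComplexType R p) (r c : nat).
Hypotheses (hp : prime p) (hc : (1 < c)%N) (hcp : coprime c p).
Variable gam : 'I_r -> Cp.
Hypothesis hgam : forall j, padic_int (gam j).
Local Notation v := (padic_abs : Cp -> R).
Local Notation xi_tup := (@xi_tuples R p Cp r c).
Implicit Types (m : 'I_r -> nat) (rho xi : {ffun 'I_r -> Cp}) (I : {set 'I_r}) (j : 'I_r).

Let c_gt0 : (0 < c)%N. Proof. exact: ltnW. Qed.

Definition riemann_point N (a : {ffun 'I_r -> 'I_(p ^ N)}) : 'I_r -> Cp :=
  fun j => (a j)%:R.

Definition Lp_integrand m (x : 'I_r -> Cp) : Cp :=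
  patch (fun=> 0) (Lp_domain gam) (fun x =>
    \prod_(i < r) (padic_pow (angle (partial_form gam x i)) (- - (m i)%:R)
                   * teich (partial_form gam x i) ^ (m i)%:Z)) x.

Definition Lp_riemann m N : Cp :=
  \sum_(a : {ffun 'I_r -> 'I_(p ^ N)})
    Lp_integrand m (riemann_point a) * \prod_(j < r) koblitz_sum Cp c N (a j).

Lemma padic_int_partial_form N (a : {ffun 'I_r -> 'I_(p ^ N)}) i :
  padic_int (partial_form gam (riemann_point a) i).
Proof.
apply: padic_int_sum => j _; apply: padic_intM => //; exact: padic_int_nat.
Qed.

Lemma Lp_domainP N (a : {ffun 'I_r -> 'I_(p ^ N)}) :
  Lp_domain gam (riemann_point a) <->
  forall i, ~ padic_dvd 1 (partial_form gam (riemann_point a) i).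
Proof.
split=> [[]//|h]; split=> // j; exact: padic_int_nat.
Qed.

Lemma Lp_integrand_domain m N (a : {ffun 'I_r -> 'I_(p ^ N)}) :
  Lp_domain gam (riemann_point a) ->
  Lp_integrand m (riemann_point a) =
  \prod_i partial_form gam (riemann_point a) i ^+ m i.
Proof.
move=> h; rewrite /Lp_integrand patchT ?inE//.
by apply: eq_bigr => i _; rewrite angle_teich_pow.
Qed.

Lemma Lp_integrand_out m (x : 'I_r -> Cp) : ~ Lp_domain gam x -> Lp_integrand m x = 0.
Proof. by move=> h; rewrite /Lp_integrand patchN// notin_setE. Qed.

Lemma Lp_integrandE m N (a : {ffun 'I_r -> 'I_(p ^ N)}) :
  Lp_integrand m (riemann_point a) =
  (\prod_i partial_form gam (riemann_point a) i ^+ m i) *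
  \prod_i (1 - p%:R^-1 * \sum_(rho \in unity_roots p)
                 root_pow rho (partial_form gam (riemann_point a) i)).
Proof.
under [X in _ = _ * X]eq_bigr => i _.
  rewrite (padic_unit_indicator hp (padic_int_partial_form a i)).
  over.
case: (pselect (Lp_domain gam (riemann_point a))) => [h|h].
  rewrite Lp_integrand_domain// [X in _ = _ * X]big1 ?mulr1// => i _.
  by case: asboolP => // hi; have /Lp_domainP /(_ i) := h.
rewrite Lp_integrand_out//.
have /existsNP[i /contrapT hi] : ~ forall i, ~ padic_dvd 1 (partial_form gam (riemann_point a) i).
  by move=> /Lp_domainP.
by rewrite [X in _ = _ * X](bigD1 i)//= asboolT// mul0r mulr0.
Qed.

(** The condition in [rho_tuples] as one set per index, the shape required by [fsum_ffun_prod]. *)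
Definition rho_fam (I : {set 'I_r}) (i : 'I_r) : set Cp :=
  if i \in I then unity_roots p else [set 1].

Lemma rho_tuplesE I : rho_tuples I = [set f : {ffun 'I_r -> Cp} | forall i, rho_fam I i (f i)].
Proof.
by apply/seteqP; split=> f /= h i; have := h i; rewrite /rho_fam; case: ifP.
Qed.

Lemma finite_rho_fam I i : finite_set (rho_fam I i).
Proof.
by rewrite /rho_fam; case: ifP => // _; apply: finite_unity_roots; exact: prime_gt0.
Qed.

Lemma rho_fam_unity I i (x : Cp) : rho_fam I i x -> x ^+ p = 1.
Proof. by rewrite /rho_fam; case: ifP => [//|_ /= ->]; rewrite expr1n. Qed.

Definition twist (I : {set 'I_r}) (rho xi : {ffun 'I_r -> Cp}) (j : 'I_r) : Cp :=
  root_pow (\prod_(i in I | (j <= i)%N) rho i) (gam j) * xi j.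

Lemma twist_factor_unity I rho j : rho_tuples I rho ->
  root_pow (\prod_(i in I | (j <= i)%N) rho i) (gam j) ^+ p = 1.
Proof.
rewrite rho_tuplesE => h; apply: root_pow_unity => //.
by rewrite -prodrXl big1// => i _; exact: rho_fam_unity (h i).
Qed.

(** The p^N-th power removes the p-th root of unity only from level 1 on; this is why the limits
    below run over [N.+1]. *)
Lemma twist_expX I rho xi j N : (0 < N)%N -> rho_tuples I rho ->
  twist I rho xi j ^+ (p ^ N) = xi j ^+ (p ^ N).
Proof.
case: N => // N _ h; rewrite /twist exprMn expnS exprM.
by rewrite twist_factor_unity// expr1n mul1r.
Qed.

(** Exchanging the products over j <= i collects, for each j, the product of all rho_i with i >= j,
    raised to gam_j a_j; this is absorbed into the numerator of the measure. Its denominator does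
    not change, by [twist_expX]. *)
Lemma koblitz_twist I rho xi N (a : {ffun 'I_r -> 'I_(p ^ N)}) :
  (0 < N)%N -> rho_tuples I rho ->
  (\prod_i root_pow (rho i) (partial_form gam (riemann_point a) i)) *
    \prod_j koblitz (xi j) N (a j) =
  \prod_j koblitz (twist I rho xi j) N (a j).
Proof.
move=> N0 hrho; have hI := hrho; rewrite rho_tuplesE in hI.
have hu i : rho i ^+ p = 1 by exact: rho_fam_unity (hI i).
have hj (j : 'I_r) : padic_int ((a j)%:R * gam j).
  by apply: padic_intM => //; exact: padic_int_nat.
under [X in X * _]eq_bigr => i _.
  rewrite /partial_form /riemann_point root_pow_sum// big_mkcond.
  over.
rewrite exchange_big -big_split; apply: eq_bigr => j _ /=.
rewrite /koblitz twist_expX// /twist exprMn mulrA; congr (_ * _ / _).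
rewrite root_pow_prod// -prodrXl [RHS]big_mkcond; apply: eq_bigr => i _.
case: ifP => ji; last by rewrite andbF.
rewrite andbT root_powMn//; case: ifPn => // iI.
have := hI i; rewrite /rho_fam (negPf iI) => ->.
by rewrite root_pow1// expr1n.
Qed.

(** [I] is the set of factors from which the character sum, rather than 1, is selected. Outside [I]
    the entry rho_i is fixed at 1 and contributes a factor 1. *)
Lemma unit_indicator_expand N (a : {ffun 'I_r -> 'I_(p ^ N)}) :
  \prod_i (1 - p%:R^-1 * \sum_(rho \in unity_roots p)
                 root_pow rho (partial_form gam (riemann_point a) i)) =
  \sum_(I : {set 'I_r}) (- p%:R^-1) ^+ #|I| *
    \sum_(rho \in rho_tuples I)
      \prod_i root_pow (rho i) (partial_form gam (riemann_point a) i).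
Proof.
under eq_bigr => i _ do rewrite addrC -mulNr.
rewrite bigA_distr; apply: eq_bigr => I _.
rewrite rho_tuplesE (fsum_ffun_prod
  (fun i x => root_pow x (partial_form gam (riemann_point a) i)) (finite_rho_fam I)).
rewrite -prodr_const [X in _ = X * _]big_mkcond -big_split; apply: eq_bigr => i _ /=.
rewrite /rho_fam; case: ifP => // _.
by rewrite fsbig_set1 root_pow1 ?mul1r//; exact: padic_int_partial_form.
Qed.

Lemma finite_xi_tuples : finite_set (xi_tup).
Proof.
apply: (@finite_set_ffun r Cp (fun=> nontriv_roots c)) => _.
exact: finite_nontriv_roots.
Qed.

Lemma finite_rho_tuples I : finite_set (rho_tuples I : set {ffun 'I_r -> Cp}).
Proof. by rewrite rho_tuplesE; apply: (@finite_set_ffun r Cp (rho_fam I)); exact: finite_rho_fam. Qed.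

Lemma Lp_riemannE m N : (0 < N)%N ->
  Lp_riemann m N = \sum_(I : {set 'I_r}) (- p%:R^-1) ^+ #|I| *
    \sum_(rho \in rho_tuples I) \sum_(xi \in xi_tup)
      riemann_moment gam m N (twist I rho xi).
Proof.
move=> N0; rewrite /Lp_riemann.
transitivity (\sum_(a : {ffun 'I_r -> 'I_(p ^ N)}) \sum_(I : {set 'I_r})
  \sum_(rho \in rho_tuples I) \sum_(xi \in xi_tup)
   (- p%:R^-1) ^+ #|I| *
   ((\prod_i partial_form gam (riemann_point a) i ^+ m i) *
    \prod_j koblitz (twist I rho xi j) N (a j))).
  apply: eq_bigr => a _; rewrite Lp_integrandE unit_indicator_expand.
  rewrite mulr_sumr mulr_suml; apply: eq_bigr => I _.
  have -> : \prod_(j < r) koblitz_sum Cp c N (a j) =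
      \sum_(xi \in xi_tup) \prod_j koblitz (xi j) N (a j).
    apply/esym; apply: (@fsum_ffun_prod _ _ _ (fun=> nontriv_roots c) (fun j x => koblitz x N (a j))).
    by move=> _; exact: finite_nontriv_roots.
  rewrite mulrCA -!mulrA mulr_fsuml !mulr_fsumr.
  apply: eq_fsbigr => rho; rewrite inE => hrho.
  rewrite !mulr_fsumr; apply: eq_fsbigr => xi _.
  by rewrite -(koblitz_twist _ _ N0 hrho); ring.
rewrite exchange_big; apply: eq_bigr => I _ /=.
rewrite mulr_fsumr !(fsbig_finite _ _ (finite_rho_tuples I)).
under eq_bigr => a _ do rewrite (fsbig_finite _ _ (finite_rho_tuples I)).
rewrite exchange_big; apply: eq_bigr => rho _ /=.
rewrite mulr_fsumr (fsbig_finite _ _ finite_xi_tuples).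
under eq_bigr => a _ do rewrite (fsbig_finite _ _ finite_xi_tuples).
rewrite exchange_big; apply: eq_bigr => xi _ /=.
by rewrite -mulr_sumr.
Qed.

Lemma bernoulli_sumE m : bernoulli_sum c gam m =
  \sum_(I : {set 'I_r}) (- p%:R^-1) ^+ #|I| *
    \sum_(rho \in rho_tuples I) \sum_(xi \in xi_tup)
      twisted_bernoulli m (twist I rho xi) gam.
Proof.
set G := fun I : {set 'I_r} => \sum_(rho \in rho_tuples I) \sum_(xi \in xi_tup)
  twisted_bernoulli m (twist I rho xi) gam.
transitivity (\sum_(0 <= d < r.+1) \sum_(I : {set 'I_r} | #|I| == d) (- p%:R^-1) ^+ d * G I).
  rewrite big_ltn//; congr (_ + _); last first.
    by apply: eq_bigr => d _; rewrite mulr_sumr.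
  (* The empty set, with its single family of ones, accounts for the untwisted sum. *)
  rewrite (big_pred1 finset.set0) => [|I]; last by rewrite cards_eq0.
  rewrite expr0 mul1r /G.
  rewrite (_ : rho_tuples finset.set0 = [set [ffun=> 1]]).
    rewrite fsbig_set1; apply: eq_fsbigr => xi _.
    suff -> : twist finset.set0 [ffun=> 1] xi = xi by [].
    apply/funext => j; rewrite /twist big_pred0 => [|i]; last by rewrite inE.
    by rewrite root_pow1 ?mul1r.
  apply/seteqP; split=> [f h|f -> i].
    by apply/ffunP => i; have := h i; rewrite !inE ffunE.
  by rewrite !inE ffunE.
under eq_bigr => d _.
  rewrite big_mkcond.
  under eq_bigr => I _ do rewrite -[(if _ then _ else _)]/(if #|I| == d then _ else _).
  over.
rewrite exchange_big; apply: eq_bigr => I _ /=.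
(* Each [I] occurs exactly once, at d = #|I|, which is at most r. *)
rewrite big_mkord (bigD1 (inord #|I|))//= inordK ?eqxx; last first.
  by rewrite ltnS -[X in (_ <= X)%N](card_ord r) max_card.
rewrite big1 ?addr0// => d dI; case: eqP => // e.
by move: dI; rewrite e inord_val eqxx.
Qed.

Lemma twist_neq1 I rho xi j N : (0 < N)%N ->
  rho_tuples I rho -> xi_tup xi ->
  twist I rho xi j ^+ (p ^ N) <> 1 /\ v (1 - twist I rho xi j ^+ (p ^ N))^-1 <= 1.
Proof.
move=> N0 hrho /(_ j)[xc x1]; rewrite twist_expX//.
have xp : xi j ^+ (p ^ N) <> 1.
  by move=> xp; apply: x1; apply: (@unity_root_coprime _ _ _ _ c (p ^ N)); rewrite ?coprimeXr.
by split=> //; apply: (@abs_inv_1sub_root _ _ _ hp _ c) => //; rewrite exprAC xc expr1n.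
Qed.

Lemma Lp_riemann_cvg m : abs_cvg v (fun N => Lp_riemann m N.+1) (bernoulli_sum c gam m).
Proof.
rewrite bernoulli_sumE; under eq_fun => N do rewrite Lp_riemannE//.
apply: abs_cvg_sum => I _; apply: abs_cvgM; first exact: abs_cvg_cst.
rewrite (fsbig_finite _ _ (finite_rho_tuples I)).
under eq_fun => N do rewrite (fsbig_finite _ _ (finite_rho_tuples I)).
(* Keeps the membership of the index in its set, on which the convergence of the single moments
   depends. *)
rewrite big_seq; under eq_fun => N do rewrite big_seq.
apply: abs_cvg_sum => rho; rewrite in_fset_set ?inE; last exact: finite_rho_tuples.
move=> hrho; rewrite (fsbig_finite _ _ finite_xi_tuples).
under eq_fun => N do rewrite (fsbig_finite _ _ finite_xi_tuples).
rewrite big_seq; under eq_fun => N do rewrite big_seq.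
apply: abs_cvg_sum => xi; rewrite in_fset_set ?inE; last exact: finite_xi_tuples.
move=> hxi; apply: riemann_moment_cvg => // [j|j N N0]; last exact: twist_neq1.
apply/eqP => t1; have [] := @twist_neq1 I rho xi j 1 isT hrho hxi.
by rewrite t1 expr1n.
Qed.

Lemma padic_mult_LE m :
  padic_mult_L (fun j => - (m j)%:R) (fun j => (m j)%:Z) gam c = bernoulli_sum c gam m.
Proof.
apply: padic_limE => //.
have /abs_cvgP h := @Lp_riemann_cvg m; apply/abs_cvgP => e /h[N hN].
(* The integral is a limit over all levels, while [Lp_riemann_cvg] starts at level 1. *)
by exists N.+1; case=> // n; rewrite ltnS => /hN.
Qed.

Lemma padic_int_Lp_riemann m N : padic_int (Lp_riemann m N).
Proof.
apply: padic_int_sum => a _; apply: padic_intM; last first.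
  by apply: padic_int_prod => j _; exact: padic_int_koblitz_sum.
case: (pselect (Lp_domain gam (riemann_point a))) => h; last first.
  by rewrite Lp_integrand_out//; exact: (padic_int_nat _ 0).
rewrite Lp_integrand_domain//; apply: padic_int_prod => i _.
by apply: padic_intX; exact: padic_int_partial_form.
Qed.

(** The domain does not depend on the exponents, so both integrands vanish at the same points. On
    the domain the i-th factors agree modulo p^(l_i) by [padic_euler], and the weights lie in
    Z_p. *)
Lemma Lp_riemann_sub_le m n l k N :
  (forall j, (0 < l j)%N) -> (forall j, (k <= l j)%N) ->
  (forall j, m j = n j %[mod (p - 1) * p ^ (l j - 1)]) ->
  v (Lp_riemann m N - Lp_riemann n N) <= (p%:R^-1 : R) ^+ k.
Proof.
move=> l0 kl mn; rewrite -sumrB; apply: abs_sum_le => [|a _]; first exact: eps_ge0.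
rewrite -mulrBl mulrC absM_le1//.
  by apply: padic_int_abs; apply: padic_int_prod => j _; exact: padic_int_koblitz_sum.
case: (pselect (Lp_domain gam (riemann_point a))) => h; last first.
  by rewrite !Lp_integrand_out// subrr abs0 eps_ge0.
rewrite !Lp_integrand_domain//.
have hX i q : v (partial_form gam (riemann_point a) i ^+ q) <= 1.
  by apply: padic_int_abs; apply: padic_intX; exact: padic_int_partial_form.
apply: abs_prod_sub_le => // i.
apply: (@le_trans _ _ ((p%:R^-1 : R) ^+ l i)); last by rewrite eps_le.
apply: padic_euler => //; first exact: padic_int_partial_form.
by have /Lp_domainP := h.
Qed.

Lemma bernoulli_sum_congr m n l k :
  (forall j, (0 < l j)%N) -> (forall j, (k <= l j)%N) ->
  (forall j, m j = n j %[mod (p - 1) * p ^ (l j - 1)]) ->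
  padic_congr k (bernoulli_sum c gam m) (bernoulli_sum c gam n).
Proof.
move=> l0 kl mn.
have int q : padic_int (bernoulli_sum c gam q).
  by apply: abs_cvg_padic_int (Lp_riemann_cvg q) => N; exact: padic_int_Lp_riemann.
split=> //; apply/padic_dvdP => //; split; first exact: padic_intB.
have h : abs_cvg v (fun N => Lp_riemann m N.+1 + -1 * Lp_riemann n N.+1)
    (bernoulli_sum c gam m + -1 * bernoulli_sum c gam n).
  apply: abs_cvgD; first exact: Lp_riemann_cvg.
  by apply: abs_cvgM; [exact: abs_cvg_cst|exact: Lp_riemann_cvg].
rewrite -mulN1r; apply: abs_cvg_le h => N.
by rewrite mulN1r; exact: Lp_riemann_sub_le mn.
Qed.

End RiemannSums.

(** * The minimum of the exponents, and the theorem *)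

Lemma min_fam_le (r : nat) (l : 'I_r -> nat) j : (min_fam l <= l j)%N.
Proof.
rewrite /min_fam; move: (\max_(_ < r) _)%N => x.
elim: (index_enum _) (mem_index_enum j) => // i s IH.
by rewrite big_cons in_cons geq_min => /predU1P[->|/IH ->]; rewrite ?leqnn ?orbT.
Qed.

Theorem theorem3p10 (R : realType) (p : nat) (hp : prime p)
    (Cp : padicComplexType R p) (r : nat) (hr : (0 < r)%N)
    (m n l : 'I_r -> nat) (hl : forall j, (0 < l j)%N)
    (hmn : forall j, m j = n j %[mod (p - 1) * p ^ (l j - 1)])
    (gam : 'I_r -> Cp) (hgam : forall j, padic_int (gam j))
    (c : nat) (hc : (1 < c)%N) (hcp : coprime c p) :
  padic_congr (min_fam l)
    (padic_mult_L (fun j => - (m j)%:R) (fun j => (m j)%:Z) gam c)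
    (padic_mult_L (fun j => - (n j)%:R) (fun j => (n j)%:Z) gam c)
  /\
  padic_congr (min_fam l)
    (bernoulli_sum c gam m)
    (bernoulli_sum c gam n).
Proof.
rewrite !padic_mult_LE//.
have h := bernoulli_sum_congr hp hc hcp hgam hl (min_fam_le l) hmn.
by split.
Qed.
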